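(* Let $k\ge 2$ be an integer and define $$S=\{(n_1,\dots,n_{k-1})\in\mathbb{Z}^{k-1} : n_1>n_2>\cdots>n_{k-1}>0 \text{ and } \gcd(n_1,\dots,n_{k-1})=1\}.$$ For $\mathbf{n}=(n_1,\dots,n_{k-1})\in S$ define $f_{\mathbf{n}}(z)=z^{n_1}+\cdots+z^{n_{k-1}}+1$, and let $$S_{\mathrm{c}}=\{\mathbf{n}\in S : M(f_{\mathbf{n}})=1\}.$$ Then the set $S_{\mathrm{c}}$ is finite if and only if $k$ is a prime number.
   Context: For a nonzero polynomial $f\in\mathbb{C}[z]$, the Mahler measure is $M(f)=\exp\left(\int_0^1\log|f(e^{2\pi i t})|\,dt\right)$. *)

(* Defs.v *)
From mathcomp Require Export all_boot all_order all_algebra.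
From mathcomp Require Export all_classical all_reals all_analysis.
From mathcomp Require Export complex.

Set Implicit Arguments.
Unset Strict Implicit.
Unset Printing Implicit Defensive.

Import Order.TTheory GRing.Theory Num.Theory.
Import numFieldNormedType.Exports.

Local Open Scope classical_set_scope.
Local Open Scope ring_scope.
Local Open Scope complex_scope.

Definition unit_circle (R : realType) (t : R) : R[i] :=
  cos (2 * pi * t) +i* sin (2 * pi * t).

(* Lebesgue integral. The norm of R[i] takes values in R[i], hence the Re.
   The library sets ln 0 = 0; for f != 0 this only affects the finitely many t
   at which f vanishes. The value at f = 0 is meaningless. *)
Definition mahler_measure (R : realType) (f : {poly R[i]}) : R :=
  expR (\int[lebesgue_measure]_(t in `[0, 1])
          ln (complex.Re `|f.[unit_circle t]|)).

(* sorted >%R (rcons n 0) is the chain n_1 > n_2 > ... > n_{k-1} > 0. *)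
Definition exponent_set (k : nat) : set (k.-1.-tuple int) :=
  [set n | sorted >%R (rcons n 0) /\ \big[gcdz/0]_(m <- n) m = 1].
Arguments exponent_set k : clear implicits.

(* `|m|%N is m itself, as a natural number, for the entries of an n in
   exponent_set k, which are positive. *)
Definition sum_poly (R : realType) (k : nat) (n : k.-1.-tuple int) : {poly R[i]} :=
  (\sum_(m <- n) 'X^`|m|%N) + 1.

Definition cyclotomic_exponent_set (R : realType) (k : nat) :
    set (k.-1.-tuple int) :=
  [set n | exponent_set k n /\ mahler_measure (sum_poly R n) = 1].
Arguments cyclotomic_exponent_set R k : clear implicits.

(* Main.v *)
(* If k = a b with a, b > 1, the polynomials
   (1 + z + ... + z^(b-1)) (1 + z^N + ... + z^((a-1)N)), N >= b, are infinitely
   many members of S_c.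

   Let k be prime and f = f_n with M(f) = 1. By Jensen's formula and Kronecker's
   theorem f is a product of cyclotomic polynomials. By Mann's theorem on vanishing
   sums of roots of unity, the multiplicity in f of a primitive m-th root of unity
   depends only on which of the numbers d |n_i - n_j|, d <= k!, are divisible by m;
   Moebius inversion turns this into an identity
   f prod_j (z^(c_j) - 1) = prod_j (z^(d_j) - 1) in which the number of factors is
   bounded in terms of k.

   Suppose that n and n' have such identities of the same shape and that, after
   expanding both sides, the same exponents coincide. Then the identity holds in two
   variables, with x^(n'_i) y^(n_i) for z^(n_i). Group the factors by the direction
   of (c'_j, c_j). Taking on both sides the part of least weight, for the weight that
   vanishes on one direction v, shows that the factors of direction v contribute the
   sum over a face E_v of the exponents. Hence k = f(1) = prod_v |E_v|, and as k is
   prime one of the faces is everything: n and n' are proportional, and n = n'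
   because both have gcd 1. As there are finitely many shapes, S_c is finite. *)

Require Import Defs.
From mathcomp Require Import zify ring lra.
From mathcomp Require Import algC cyclotomic measurable_realfun.
Set Implicit Arguments.
Unset Strict Implicit.
Unset Printing Implicit Defensive.

Import Order.TTheory GRing.Theory Num.Theory.
Import numFieldNormedType.Exports.

Local Open Scope ring_scope.

(** * Vanishing sums of roots of unity *)

Lemma map_poly_intr_ratr (F : numFieldType) (p : {poly int}) :
  map_poly (intr : int -> F) p = map_poly ratr (map_poly intr p).
Proof. by rewrite -map_poly_comp; apply: eq_map_poly => a /=; rewrite ratr_int. Qed.

(** All primitive [m]-th roots of unity have the same minimal polynomial over the rationals, the
    [m]-th cyclotomic polynomial. *)
Lemma root_int_conj (p : {poly int}) (m : nat) (z z' : algC) :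
  m.-primitive_root z -> m.-primitive_root z' ->
  root (map_poly intr p) z -> root (map_poly intr p) z'.
Proof.
move=> hz hz'; rewrite map_poly_intr_ratr.
have [q [Dq _] dv] := minCpolyP z.
have [q' [Dq' _] dv'] := minCpolyP z'.
have eqq : q = q'.
  apply: (@map_poly_inj _ _ (@ratr algC)); rewrite -Dq -Dq'.
  by rewrite !(minCpoly_cyclotomic hz, minCpoly_cyclotomic hz') -!Cintr_Cyclotomic.
by rewrite dv eqq -dv'.
Qed.

Lemma sum_int_conj (I : finType) (n : I -> nat) (w : I -> int) m (z z' : algC) :
  m.-primitive_root z -> m.-primitive_root z' ->
  \sum_i (w i)%:~R * z ^+ n i = 0 -> \sum_i (w i)%:~R * z' ^+ n i = 0.
Proof.
move=> hz hz'; pose p : {poly int} := \sum_i w i *: 'X^(n i).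
have pE x : (map_poly (intr : int -> algC) p).[x] = \sum_i (w i)%:~R * x ^+ n i.
  rewrite rmorph_sum /= horner_sum; apply: eq_bigr => i _.
  by rewrite map_polyZ /= map_polyXn hornerZ hornerXn.
by rewrite -!pE => /rootP h; apply/rootP; exact: (root_int_conj hz hz' h).
Qed.

Lemma sum_prim_root_expr (F : fieldType) (q : nat) (x : F) (n : nat) :
  q.-primitive_root x ->
  \sum_(t < q) (x ^+ n) ^+ t = if (q %| n)%N then q%:R else 0.
Proof.
move=> hx; case: ifP => [dv|ndv].
  rewrite (eq_bigr (fun=> 1)) ?sumr_const ?card_ord // => t _.
  by move: dv; rewrite (prim_order_dvd hx) => /eqP ->; rewrite expr1n.
have n1 : x ^+ n - 1 != 0 by rewrite subr_eq0 -(prim_order_dvd hx) ndv.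
apply: (mulfI n1); rewrite -subrX1 -exprM mulnC exprM (prim_expr_order hx).
by rewrite expr1n subrr mulr0.
Qed.

(* Twisting z by the q-th roots of unity separates the residue classes of the
   exponents modulo q. If q^2 | m every twist is conjugate to z. Otherwise at most one
   is not, so the class sums are proportional to powers of a root of unity; one of
   them is empty as #|I| < q, hence all vanish. *)
Lemma residue_sums0 (I : finType) (n : I -> nat) (w : I -> int) (m q : nat)
    (z : algC) :
  m.-primitive_root z -> prime q -> (q %| m)%N ->
  (#|I| < q)%N \/ (q ^ 2 %| m)%N ->
  \sum_i (w i)%:~R * z ^+ n i = 0 ->
  forall j : nat, \sum_(i | n i == j %[mod q]) (w i)%:~R * z ^+ n i = 0.
Proof.
move=> hz pq dq hq h0.
have m0 := prim_order_gt0 hz; have q0 := prime_gt0 pq.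
pose m' := (m %/ q)%N.
have mE : m = (q * m')%N by rewrite mulnC divnK.
have [x xE hx] : exists2 x, x = z ^+ m' & q.-primitive_root x.
  by exists (z ^+ m') => //; exact: dvdn_prim_root.
have z0 : z != 0.
  apply: contraTneq hz => ->; apply/negP => h; move: (prim_expr_order h).
  by move/eqP; rewrite expr0n gtn_eqF // eq_sym oner_eq0.
pose G (t : nat) := \sum_i (w i)%:~R * (z * x ^+ t) ^+ n i.
have Gcop t : coprime (1 + t * m') m -> G t = 0.
  move=> cop; apply: (sum_int_conj hz _ h0).
  have -> : z * x ^+ t = z ^+ (1 + t * m') by rewrite exprD expr1 mulnC exprM xE.
  by rewrite prim_root_exp_coprime.
pose S j := \sum_(i | n i == j %[mod q]) (w i)%:~R * z ^+ n i.
(* Fourier inversion modulo [q]; the multiplier [q.-1 * j] stands for [-j] among natural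
   exponents. *)
have inv j : \sum_(t < q) x ^+ ((q.-1 * j) * t) * G t = q%:R * S j.
  rewrite /G; under eq_bigr do rewrite mulr_sumr.
  rewrite exchange_big /= /S mulr_sumr [RHS]big_mkcond /=; apply: eq_bigr => i _.
  have -> : (n i == j %[mod q]) = (q %| q.-1 * j + n i)%N.
    rewrite -(eqn_modDl (q.-1 * j)).
    have -> : (q.-1 * j + j = q * j)%N by rewrite -mulSnr prednK.
    by rewrite modnMr.
  under eq_bigr => t _.
    rewrite exprMn mulrCA [x ^+ _ * _]mulrCA mulrA -!exprM [(t * _)%N]mulnC -exprD.
    rewrite -mulnDl exprM.
    over.
  rewrite -mulr_sumr (sum_prim_root_expr _ hx).
  by case: ifP => _; rewrite ?mulr0 // mulrC.
have copm' t : coprime (1 + t * m') m'.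
  by rewrite coprime_sym /coprime addnC gcdnMDl gcdn1.
suff G0 t : (t < q)%N -> G t = 0.
  move=> j; have /eqP := inv j; rewrite big1 => [|t _]; last by rewrite G0 ?mulr0.
  by rewrite eq_sym mulf_eq0 (negbTE (prim_root_natf_neq0 hx)) => /eqP.
case: (boolP (q %| m')%N) => [dqm'|ndq] ltq.
  apply: Gcop; rewrite mE coprimeMr copm' andbT.
  exact: coprime_dvdr dqm' (copm' t).
case: hq => [cardq|]; last first.
  by rewrite mE -mulnn dvdn_pmul2l // (negbTE ndq).
(* [1 + s * m'] is prime to [m'], so only the factor [q] of [m] can keep the twist from being
   conjugate to [z]. *)
have Gq s : G s != 0 -> (q %| 1 + s * m')%N.
  move=> Gs; apply: contraNT Gs => nd; apply/eqP/Gcop.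
  by rewrite mE coprimeMr copm' andbT coprime_sym prime_coprime.
have Guniq s s' : (s < q)%N -> (s' < q)%N -> G s != 0 -> G s' != 0 -> s = s'.
  wlog les : s s' / (s <= s')%N.
    by move=> H; case: (leqP s s') => [|/ltnW] le *; [|symmetry]; apply: H.
  move=> lts lts' /Gq d1 /Gq d2.
  have : (q %| (s' - s) * m')%N.
    by rewrite mulnBl -(subnDl 1%N) dvdn_sub.
  rewrite Gauss_dvdl ?prime_coprime // => /dvdn_leq.
  by case: (posnP (s' - s)) => [|p] h; lia.
have [j0 hj0] : exists j0 : 'I_q, forall i, ((n i %% q)%N != j0).
  have : ~~ ('I_q \subset codom (fun i => Ordinal (ltn_pmod (n i) q0))).
    apply: contraTN cardq => /subset_leq_card.
    by rewrite card_ord -leqNgt => /leq_trans; apply; exact: leq_image_card.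
  case/subsetPn => j0 _ hj0; exists j0 => i; apply: contra hj0 => /eqP hi.
  by apply/codomP; exists i; apply: val_inj.
(* At the missed class [j0] the inversion formula has 0 on the right and only the twist [t] on the
   left. *)
apply: contraTeq cardq => Gt.
have /eqP := inv j0; rewrite (bigD1 (Ordinal ltq)) //= big1 ?addr0 => [|s hs]; last first.
  apply/eqP; rewrite mulf_eq0 orbC; apply/orP; left.
  by apply: contraNT hs => Gs; apply/eqP/val_inj; exact: (Guniq _ _ (ltn_ord s) ltq Gs Gt).
rewrite /S big1 => [|i /eqP hi]; last first.
  by have := hj0 i; rewrite hi modn_small // eqxx.
rewrite mulr0 mulf_eq0 (negbTE Gt) orbF expf_eq0.
case/andP=> _ /eqP x0.
by have := prim_expr_order hx; move/eqP; rewrite x0 expr0n gtn_eqF // eq_sym oner_eq0.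
Qed.

(** Take [q] with a larger exponent in [m] than in [k!]. If [q <= k], then [q] divides [k!], so its
    exponent in [m] is at least 2. These are the two cases of [residue_sums0]. *)
Lemma not_dvdn_fact k m : (0 < m)%N -> ~~ (m %| k`!)%N ->
  exists q, [/\ prime q, (q %| m)%N & (k < q)%N \/ (q ^ 2 %| m)%N].
Proof.
move=> m0 nd.
have [q pq lq] : exists2 q, prime q & (logn q k`! < logn q m)%N.
  have : ~~ all (fun q : nat => q ^ logn q m %| k`!)%N (primes m).
    apply: contra nd => /allP h; apply/dvdn_partP => // q hq.
    by rewrite p_part; exact: h.
  case/allPn => q; rewrite mem_primes => /and3P[pq _ _] hq; exists q => //.
  by rewrite ltnNge -pfactor_dvdn ?fact_gt0.
have qm : (q %| m)%N.
  by rewrite -[q]expn1 pfactor_dvdn //; apply: leq_ltn_trans lq.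
exists q; split=> //; case: (ltnP k q) => [lt|le]; [by left|right].
rewrite pfactor_dvdn //; apply: leq_ltn_trans lq.
by rewrite -pfactor_dvdn ?fact_gt0 // expn1 dvdn_fact // prime_gt0.
Qed.

(** Induction on the order [m]. If [m] divides [k!], there is a single class. Otherwise
    [residue_sums0] splits the sum modulo a prime [q], and each residue class, divided by [z ^+ j],
    is a vanishing sum in [z ^+ q], which has order [m / q]. *)
Lemma mann_theorem (I : finType) (k : nat) (n : I -> nat) (w : I -> int) m
    (z : algC) :
  (#|I| <= k)%N -> m.-primitive_root z ->
  \sum_i (w i)%:~R * z ^+ n i = 0 ->
  forall c, \sum_(i | z ^+ (k`! * n i) == c) (w i)%:~R * z ^+ n i = 0.
Proof.
move=> cardI; elim/ltn_ind: m z n w => m IHm z n w hz h0 c.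
have m0 := prim_order_gt0 hz.
have [/dvdnP [a ka]|nd] := boolP (m %| k`!)%N.
  have e i : z ^+ (k`! * n i) = 1.
    by rewrite exprM ka mulnC exprM (prim_expr_order hz) !expr1n.
  have [->|c1] := eqVneq c 1.
    by rewrite -[RHS]h0; apply: eq_bigl => i; rewrite e eqxx.
  by rewrite big_pred0 // => i; rewrite e eq_sym (negbTE c1).
have [q [pq dq hq]] := not_dvdn_fact m0 nd.
have q0 := prime_gt0 pq.
have hq' : (#|I| < q)%N \/ (q ^ 2 %| m)%N.
  by case: hq => [lt|]; [left; exact: leq_ltn_trans lt|right].
have hj := residue_sums0 hz pq dq hq' h0.
have hzq : (m %/ q).-primitive_root (z ^+ q).
  by have := dvdn_prim_root hz (dvdn_div dq); rewrite divnA // mulKn.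
have ltmq : (m %/ q < m)%N by rewrite ltn_Pdiv ?prime_gt1.
rewrite (partition_big (fun i => Ordinal (ltn_pmod (n i) q0)) xpredT) //=.
rewrite big1 // => j _.
have z0 : z != 0 by rewrite (prim_root_eq0 hz) -lt0n.
(* Setting the weights to 0 outside the class keeps the index type, and with it the bound
   [#|I| <= k]. *)
pose w' i := if (n i %% q)%N == j then w i else 0.
have wE i : (n i %% q)%N == j ->
    (w i)%:~R * z ^+ n i = z ^+ j * ((w' i)%:~R * (z ^+ q) ^+ (n i %/ q)).
  move=> hi; rewrite /w' hi mulrCA -exprM -exprD {1}(divn_eq (n i) q) (eqP hi).
  by rewrite addnC mulnC.
have h0' : \sum_i (w' i)%:~R * (z ^+ q) ^+ (n i %/ q) = 0.
  apply: (mulfI (expf_neq0 j z0)); rewrite mulr0 -[RHS](hj j) mulr_sumr.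
  rewrite [RHS]big_mkcond /=; apply: eq_bigr => i _.
  rewrite [(j %% q)%N]modn_small //; case: ifP => hi; first by rewrite wE.
  by rewrite /w' hi mul0r mulr0.
have := IHm _ ltmq _ _ _ hzq h0' (c / z ^+ (k`! * j)).
move/(congr1 ( *%R (z ^+ j))); rewrite mulr0 mulr_sumr => h; rewrite -[RHS]h {h}.
rewrite [LHS]big_mkcond [RHS]big_mkcond /=; apply: eq_bigr => i _.
rewrite -val_eqE /=; case: (boolP (_ %% _ == _)%N) => hi; last first.
  by rewrite andbF /w' (negbTE hi) mul0r mulr0 if_same.
rewrite andbT wE //; congr (if _ then _ else _).
have -> : z ^+ (k`! * n i) = (z ^+ q) ^+ (k`! * (n i %/ q)) * z ^+ (k`! * j).
  rewrite -exprM -exprD mulnCA -mulnDr [in LHS](divn_eq (n i) q) (eqP hi).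
  by rewrite [(q * _)%N]mulnC.
have zj0 := expf_neq0 (k`! * j) z0.
by rewrite -[in RHS](inj_eq (mulIf zj0)) divfK.
Qed.

(* The value 1 at coinciding exponents only serves to keep all gaps positive. *)
Definition gap_exponent (I : finType) (n : I -> nat) (K : nat) (x : I * I * 'I_K) : nat :=
  if n x.1.1 == n x.1.2 then 1%N
  else (x.2.+1 * ((n x.1.1 - n x.1.2) + (n x.1.2 - n x.1.1)))%N.

Lemma gap_exponent_gt0 (I : finType) (n : I -> nat) K (x : I * I * 'I_K) :
  (0 < gap_exponent n x)%N.
Proof. by rewrite /gap_exponent; case: eqVneq => // h; rewrite muln_gt0 /=; lia. Qed.

Lemma dvdn_gap_exponent (I : finType) (n : I -> nat) K m (z : algC) i j (d : 'I_K) :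
  m.-primitive_root z -> n i != n j ->
  (m %| gap_exponent n (i, j, d))%N = (z ^+ (d.+1 * n i) == z ^+ (d.+1 * n j)).
Proof.
move=> hz nij; rewrite /gap_exponent (negbTE nij) /=.
wlog le : i j nij / (n j <= n i)%N.
  move=> H; case: (leqP (n j) (n i)) => [|/ltnW] le; first exact: H.
  by rewrite eq_sym -H // 1?eq_sym // addnC.
have -> : (n j - n i = 0)%N by apply/eqP; rewrite subn_eq0.
rewrite addn0 mulnBr -eqn_mod_dvd ?leq_mul2l ?le ?orbT //.
by rewrite (eq_prim_root_expr hz).
Qed.

(** By [mann_theorem] the sum splits into classes on which [z ^+ (k! * n i)] is constant, and [z]
    and [z'] have the same classes by the hypothesis on the gaps. In one class let [n i0] be the
    least exponent and [g] the gcd of the differences: the class sum is [z ^+ n i0] times a sum in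
    [z ^+ g]. The order of [z ^+ g] divides [k!] and can be read off from the gaps, so [z ^+ g] and
    [z' ^+ g] are conjugate. *)
Lemma vanishing_sum_transfer (I : finType) (k : nat) (n : I -> nat) (w : I -> int)
    m m' (z z' : algC) :
  (#|I| <= k)%N -> m.-primitive_root z -> m'.-primitive_root z' ->
  (forall x : I * I * 'I_k`!, (m %| gap_exponent n x)%N = (m' %| gap_exponent n x)%N) ->
  \sum_i (w i)%:~R * z ^+ n i = 0 -> \sum_i (w i)%:~R * z' ^+ n i = 0.
Proof.
move=> cardI hz hz' hx h0.
have hE d i j : (0 < d <= k`!)%N ->
    (z ^+ (d * n i) == z ^+ (d * n j)) = (z' ^+ (d * n i) == z' ^+ (d * n j)).
  case: d => // d ltd; have [->|nij] := eqVneq (n i) (n j); first by rewrite !eqxx.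
  have := hx (i, j, Ordinal ltd).
  by rewrite (dvdn_gap_exponent _ hz) // (dvdn_gap_exponent _ hz').
have K0 : (0 < k`!)%N := fact_gt0 k.
pose p i := [set j | z ^+ (k`! * n j) == z ^+ (k`! * n i)].
have pE i j : (p i == p j) = (z ^+ (k`! * n i) == z ^+ (k`! * n j)).
  apply/eqP/eqP => [/setP/(_ i)|e]; first by rewrite !inE eqxx => /esym/eqP.
  by apply/setP => l; rewrite !inE e.
rewrite (partition_big p xpredT) //= big1 // => B _.
have [/existsP [i1 /eqP Bi1]|/existsPn hB] := boolP [exists i, p i == B]; last first.
  by rewrite big1 // => i hi; have := hB i; rewrite hi.
rewrite -{}Bi1.
case: (@arg_minnP _ i1 (fun i => p i == p i1) n (eqxx _)) => i0 hi0 min_i0.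
rewrite -(eqP hi0) in min_i0 *.
have hB : \sum_(i | p i == p i0) (w i)%:~R * z ^+ n i = 0.
  rewrite -[RHS](mann_theorem cardI hz h0 (z ^+ (k`! * n i0))).
  by apply: eq_bigl => i; rewrite pE.
pose g := \big[gcdn/0]_(i | p i == p i0) (n i - n i0)%N.
pose t i := ((n i - n i0) %/ g)%N.
have tE i : p i == p i0 -> n i = (n i0 + g * t i)%N.
  move=> hi; rewrite /t mulnC divnK ?subnKC ?min_i0 //.
  exact: (@biggcdn_inf _ i (fun i => p i == p i0) _ _ hi (dvdnn _)).
have gdv d u (y : algC) : u.-primitive_root y ->
    (u %| d * g)%N = [forall (i | p i == p i0), y ^+ (d * n i) == y ^+ (d * n i0)].
  move=> hy; rewrite /g (big_morph (muln d) (muln_gcdr d) (muln0 d)).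
  apply/dvdn_biggcdP/forall_inP => h i hi; have := h i hi.
    by rewrite mulnBr -eqn_mod_dvd ?(eq_prim_root_expr hy) // leq_mul2l min_i0 ?orbT.
  by rewrite mulnBr -eqn_mod_dvd ?(eq_prim_root_expr hy) // leq_mul2l min_i0 ?orbT.
have gE d : (0 < d <= k`!)%N -> (m %| d * g)%N = (m' %| d * g)%N.
  move=> hd; rewrite (gdv _ _ _ hz) (gdv _ _ _ hz'); apply: eq_forallb => i.
  by rewrite hE.
have hg := exp_prim_root hz g; have hg' := exp_prim_root hz' g.
set o := (m %/ gcdn g m)%N in hg; set o' := (m' %/ gcdn g m')%N in hg'.
have oE d : (0 < d <= k`!)%N -> (o %| d)%N = (o' %| d)%N.
  move=> hd; rewrite (prim_order_dvd hg) (prim_order_dvd hg') -!exprM.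
  by rewrite -(prim_order_dvd hz) -(prim_order_dvd hz') ![(g * d)%N]mulnC gE.
have oK : (o %| k`!)%N.
  rewrite (prim_order_dvd hg) -exprM -(prim_order_dvd hz) mulnC (gdv _ _ _ hz).
  by apply/forall_inP => i; rewrite pE.
have oK' : (o' %| k`!)%N by rewrite -oE ?K0 ?leqnn.
(* Both orders divide [k!], hence are themselves admissible values of [d] in [oE]. *)
have eqo : o = o'.
  apply/eqP; rewrite eqn_dvd.
  have ho : (0 < o <= k`!)%N by rewrite (prim_order_gt0 hg) (dvdn_leq K0 oK).
  have ho' : (0 < o' <= k`!)%N by rewrite (prim_order_gt0 hg') (dvdn_leq K0 oK').
  by rewrite (oE _ ho') dvdnn -(oE _ ho) dvdnn.
rewrite -eqo in hg'.
pose w' i := if p i == p i0 then w i else 0.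
have sumE (y : algC) : \sum_(i | p i == p i0) (w i)%:~R * y ^+ n i =
    y ^+ n i0 * \sum_i (w' i)%:~R * (y ^+ g) ^+ t i.
  rewrite big_mkcond mulr_sumr /=; apply: eq_bigr => i _; rewrite /w'.
  case: ifP => hi; last by rewrite mul0r mulr0.
  by rewrite mulrCA -exprM -exprD -tE.
rewrite sumE (sum_int_conj hg hg') ?mulr0 //.
apply: (mulfI (expf_neq0 (n i0) _ : z ^+ n i0 != 0)).
  by rewrite (prim_root_eq0 hz) -lt0n (prim_order_gt0 hz).
by rewrite -sumE hB mulr0.
Qed.

(** * Multiplicities of the cyclotomic factors *)

Lemma dvdp_Xn (F : fieldType) (e : nat) (q : {poly F}) :
  ('X^e %| q) = [forall j : 'I_e, q`_j == 0].
Proof.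
apply/idP/forallP => [/dvdpP [r ->] j|h].
  by rewrite coefMXn ltn_ord.
rewrite -(poly_take_drop e q) dvdp_addl ?dvdp_mulIr //.
have -> : take_poly e q = 0; last exact: dvdp0.
apply/polyP => j; rewrite coef_take_poly coef0; case: ifP => // hj.
by apply/eqP; exact: (h (Ordinal hj)).
Qed.

(** After the shift [X -> X + z] the multiplicity is the order of vanishing at 0. The resulting sums
    have integer weights independent of [z], the form to which [vanishing_sum_transfer] applies. *)
Lemma mup_sum_Xn (F : fieldType) (I : finType) (n : I -> nat) (z : F) (e : nat) :
  z != 0 -> \sum_i 'X^(n i) != 0 :> {poly F} ->
  (e <= mup z (\sum_i 'X^(n i)))%N =
  [forall j : 'I_e, \sum_i ('C(n i, j))%:R * z ^+ n i == 0].
Proof.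
move=> z0 f0; rewrite mup_geq //.
set f := \sum_i _; pose q := f \Po ('X + z%:P).
have qf : f = q \Po ('X - z%:P).
  by rewrite -comp_polyA comp_polyD comp_polyX comp_polyC subrK comp_polyXr.
have -> : (('X - z%:P) ^+ e %| f) = ('X^e %| q).
  apply/idP/idP => [h|/(dvdp_comp_poly ('X - z%:P))].
    have := dvdp_comp_poly ('X + z%:P) h; rewrite rmorphXn /= comp_polyB.
    by rewrite comp_polyX comp_polyC addrK.
  by rewrite -qf comp_Xn_poly.
rewrite dvdp_Xn; apply: eq_forallb => j.
have -> : q`_j = \sum_i ('C(n i, j))%:R * z ^+ (n i - j).
  rewrite /q /f rmorph_sum coef_sum; apply: eq_bigr => i _.
  rewrite /= comp_Xn_poly addrC exprDn coef_sum.
  have [lj|lj] := leqP j (n i); last first.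
    rewrite bin_small // mul0r big1 // => l _.
    rewrite coefMn -rmorphXn coefCM coefXn.
    by rewrite gtn_eqF ?mulr0 ?mul0rn // (leq_ltn_trans _ lj) // -ltnS.
  rewrite (bigD1 (Ordinal (lj : (j < (n i).+1)%N))) //= big1 ?addr0.
    by rewrite coefMn -rmorphXn coefCM coefXn eqxx mulr1 mulr_natl.
  move=> l hl; rewrite coefMn -rmorphXn coefCM coefXn eq_sym.
  by move: hl; rewrite -val_eqE /= => /negbTE ->; rewrite mulr0 mul0rn.
(* Multiplying by [z ^+ j] removes the truncated subtraction; for [n i < j] the binomial coefficient
   is 0. *)
rewrite -(inj_eq (mulfI (expf_neq0 j z0))) mulr0 mulr_sumr.
congr (_ == _); apply: eq_bigr => i _.
have [lj|lj] := leqP j (n i); last by rewrite bin_small // !mul0r mulr0.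
by rewrite mulrCA -exprD subnKC.
Qed.

Lemma dvdp_exp_deriv (F : fieldType) (z : F) (e : nat) (p : {poly F}) :
  ('X - z%:P) ^+ e.+1 %| p -> ('X - z%:P) ^+ e %| p^`().
Proof.
case/dvdpP => r ->; rewrite derivM exprS dvdp_add //.
  by rewrite mulrA dvdp_mulIr.
by rewrite -exprS deriv_exp derivXsubC mul1r -mulr_natl mulrA dvdp_mulIr.
Qed.

(* [X p' - n p] kills the monomial of exponent [n] and costs one multiplicity. *)
Lemma sparse_root_mult (F : numFieldType) (I : finType) (n : I -> nat) (z : F)
    (A : {set I}) (w : I -> F) :
  injective n -> z != 0 -> A != finset.set0 -> (forall i, i \in A -> w i != 0) ->
  ~~ (('X - z%:P) ^+ #|A| %| \sum_(i in A) w i *: 'X^(n i)).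
Proof.
move=> inj_n z0; move Ec : #|A| => c; elim: c A w Ec => [|c IHc] A w Ec A0 hw.
  by move/eqP: Ec; rewrite cards_eq0 (negbTE A0).
have [i0 i0A] : exists i0, i0 \in A by apply/finset.set0Pn.
have [A1|A1] := eqVneq (A :\ i0) finset.set0.
  have cA : c = 0%N.
    by move: Ec; rewrite (cardsD1 i0) i0A A1 cards0 => -[].
  rewrite cA expr1 (big_setD1 i0) //= A1 big_set0 addr0 dvdp_XsubCl rootE.
  by rewrite hornerZ hornerXn mulf_neq0 ?hw ?expf_neq0.
have cA : #|A :\ i0| = c by move: Ec; rewrite (cardsD1 i0) i0A => -[].
apply: contra (IHc _ (fun i => w i * ((n i)%:R - (n i0)%:R)) cA A1 _); last first.
  move=> i; rewrite !inE => /andP [ni iA]; rewrite mulf_neq0 ?hw // subr_eq0.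
  by rewrite eqr_nat (inj_eq inj_n).
set p := \sum_(i in A) _ => hp.
have -> : \sum_(i in A :\ i0) (w i * ((n i)%:R - (n i0)%:R)) *: 'X^(n i)
        = 'X * p^`() - (n i0)%:R *: p.
  rewrite /p linear_sum mulr_sumr scaler_sumr -sumrB [RHS](big_setD1 i0) //=.
  have E i : 'X * (w i *: 'X^(n i))^`() - (n i0)%:R *: (w i *: 'X^(n i)) =
      (w i * ((n i)%:R - (n i0)%:R)) *: 'X^(n i).
    rewrite derivZ derivXn -scalerAr mulrnAr -exprS.
    case: (n i) => [|m] /=; last by rewrite -scaler_nat !scalerA -scalerBl mulrBr [(n i0)%:R * _]mulrC.
    by rewrite mulr0n scaler0 !sub0r scalerA mulrN mulrC scaleNr.
  rewrite E subrr mulr0 scale0r add0r; apply: eq_bigr => i _; by rewrite E.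
rewrite dvdp_sub //; first by rewrite dvdp_mull // dvdp_exp_deriv.
by rewrite -mul_polyC dvdp_mull // (dvdp_trans _ hp) // exprS dvdp_mulIr.
Qed.

Local Notation toC := (map_poly (intr : int -> algC)).

Lemma mup_Cyclotomic (d m : nat) (z : algC) :
  m.-primitive_root z -> (0 < d)%N -> mup z (toC 'Phi_d) = (d == m).
Proof.
move=> hz d0; have [y hy] := C_prim_root_exists d0.
rewrite (Cintr_Cyclotomic hy); set P := cyclotomic y d.
have P0 : P != 0 by rewrite monic_neq0 ?cyclotomic_monic.
have rootP : root P z = (d == m).
  rewrite (root_cyclotomic hy); apply/idP/eqP => [hd|->//].
  have := prim_order_dvd hz d; rewrite (prim_expr_order hd) eqxx => d1.
  have := prim_order_dvd hd m; rewrite (prim_expr_order hz) eqxx => d2.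
  by apply/eqP; rewrite eqn_dvd d1 d2.
have [e|ne] := boolP (d == m); last by rewrite mupNroot // rootP.
apply/eqP; rewrite eqn_leq mup_geq // expr1 dvdp_XsubCl rootP e andbT.
rewrite mup_leq //; apply/negP => h2.
(* A double root would be a root of the derivative [d X^(d-1)], which can vanish only at 0. *)
have : ('X - z%:P) ^+ 2 %| 'X^d - 1.
  apply: dvdp_trans h2 _; rewrite (prod_cyclotomic hy) (big_rem d) /=; last first.
    by rewrite -dvdn_divisors.
  by rewrite divnn d0 expr1 dvdp_mulIl.
move/dvdp_exp_deriv; rewrite expr1 derivB derivXn derivC subr0 dvdp_XsubCl.
rewrite /root -mulr_natl hornerM hornerXn -[d%:R%R in X in X -> _]polyC_natr hornerC.
rewrite mulf_eq0 pnatr_eq0 -[(d == 0)%N]negbK -lt0n d0 /= expf_eq0.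
by rewrite (prim_root_eq0 hz) -[(m == 0)%N]negbK -lt0n (prim_order_gt0 hz) andbF.
Qed.

Lemma mup_prod_Cyclotomic (s : seq nat) (m : nat) (z : algC) :
  m.-primitive_root z -> all (leq 1) s ->
  mup z (toC (\prod_(d <- s) 'Phi_d)) = count_mem m s.
Proof.
move=> hz; elim: s => [|d s IHs] /=.
  by move=> _; rewrite big_nil rmorph1 mupNroot // root1.
have nz r : toC (\prod_(d <- r) 'Phi_d) != 0.
  by rewrite monic_neq0 // monic_map // monic_prod // => d' _; exact: Cyclotomic_monic.
case/andP => d0 hs; rewrite big_cons rmorphM /= mupM ?IHs ?(mup_Cyclotomic hz d0) //.
by have := nz [:: d]; rewrite big_seq1.
Qed.

(** The system is triangular for inclusion: the equation for [B] determines [a B] from the values at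
    the proper subsets of [B]. *)
Lemma moebius_subset (T : finType) (f : {set T} -> int) :
  exists a : {set T} -> int, forall B : {set T}, f B = \sum_(S : {set T} | S \subset B) a S.
Proof.
suff H N : exists a : {set T} -> int,
    forall B : {set T}, (#|B| < N)%N -> f B = \sum_(S : {set T} | S \subset B) a S.
  by have [a ha] := H #|T|.+1; exists a => B; apply: ha; rewrite ltnS max_card.
elim: N => [|N [a ha]]; first by exists (fun=> 0).
pose a' (S : {set T}) := if #|S| == N then f S - \sum_(S' : {set T} | S' \proper S) a S' else a S.
exists a' => B; rewrite ltnS leq_eqVlt => /orP[/eqP cB|cB]; last first.
  rewrite ha //; apply: eq_bigr => S /subset_leq_card; rewrite /a'.
  by move/leq_ltn_trans/(_ cB) => /ltn_eqF ->.
rewrite (bigD1 B) //= {1}/a' cB eqxx.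
have -> : \sum_(S : {set T} | (S \subset B) && (S != B)) a' S =
          \sum_(S : {set T} | S \proper B) a S; last by rewrite subrK.
apply: eq_big => S; first by rewrite andbC -finset.properEneq.
rewrite andbC -finset.properEneq => /proper_card; rewrite cB /a' => lt.
by rewrite ltn_eqF.
Qed.

(** * Multiplicities as a function of the divisibility of gaps *)

Section Profile.
Variables (I : finType) (n : I -> nat) (s : seq nat).
Hypotheses (inj_n : injective n) (card_I : (1 < #|I|)%N) (s_gt0 : all (leq 1) s).
Hypothesis fs : \sum_i 'X^(n i) = \prod_(d <- s) 'Phi_d :> {poly int}.

Let k := #|I|.
Local Notation X := (I * I * 'I_k`!)%type.

Definition gap_divisors (m : nat) : {set X} := [set x | m %| gap_exponent n x]%N.

Let fC : toC (\prod_(d <- s) 'Phi_d) = \sum_i 'X^(n i).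
Proof. by rewrite -fs rmorph_sum; apply: eq_bigr => i _ /=; rewrite map_polyXn. Qed.

Let fC0 : \sum_i 'X^(n i) != 0 :> {poly algC}.
Proof.
apply/negP => /eqP /(congr1 (horner^~ 1)) /eqP.
rewrite horner_sum horner0 (eq_bigr (fun=> 1)) ?sumr_const ?pnatr_eq0.
  by rewrite eqn0Ngt => /negP; apply; exact: ltnW card_I.
by move=> i _; rewrite hornerXn expr1n.
Qed.

Let count_ge m (z : algC) e : m.-primitive_root z ->
  (e <= count_mem m s)%N =
  [forall j : 'I_e, \sum_i ('C(n i, j))%:~R * z ^+ n i == 0].
Proof.
move=> hz; rewrite -(mup_prod_Cyclotomic hz s_gt0) fC mup_sum_Xn //.
by rewrite (prim_root_eq0 hz) -lt0n (prim_order_gt0 hz).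
Qed.

(** By [sparse_root_mult] a nonzero root of a sum of [k] distinct monomials has multiplicity below
    [k]. This keeps the profiles in a finite type. *)
Lemma count_mem_lt m : (0 < m)%N -> (count_mem m s < k)%N.
Proof.
case/C_prim_root_exists => z hz; rewrite -(mup_prod_Cyclotomic hz s_gt0) fC mup_ltn //.
have := @sparse_root_mult algC I n z [set: I] (fun=> 1) inj_n.
rewrite cardsT; under eq_bigl do rewrite inE; under eq_bigr do rewrite scale1r.
apply.
- by rewrite (prim_root_eq0 hz) -lt0n (prim_order_gt0 hz).
- by rewrite -card_gt0 cardsT ltnW.
- by move=> *; exact: oner_neq0.
Qed.

Lemma count_mem_gap m m' : (0 < m)%N -> (0 < m')%N ->
  gap_divisors m = gap_divisors m' -> count_mem m s = count_mem m' s.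
Proof.
move=> m0 m0' /setP hS; have [z hz] := C_prim_root_exists m0.
have [z' hz'] := C_prim_root_exists m0'.
have hx (x : X) : (m %| gap_exponent n x)%N = (m' %| gap_exponent n x)%N.
  by have := hS x; rewrite !inE.
apply/eqP; rewrite eqn_leq (count_ge _ hz) (count_ge _ hz').
apply/andP; split; apply/forallP => j; apply/eqP.
  have := leqnn (count_mem m s); rewrite [in X in X -> _](count_ge _ hz) => /forallP/(_ j)/eqP.
  exact: (vanishing_sum_transfer (leqnn _) hz hz').
have := leqnn (count_mem m' s); rewrite [in X in X -> _](count_ge _ hz') => /forallP/(_ j)/eqP.
by apply: (vanishing_sum_transfer (leqnn _) hz' hz) => x; rewrite hx.
Qed.

(** If [m] divides no gap, the classes of [mann_theorem] are singletons, and a single power of [z]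
    does not vanish. *)
Lemma count_mem_gap0 m : (0 < m)%N -> gap_divisors m = finset.set0 -> count_mem m s = 0%N.
Proof.
move=> m0 hS; have [z hz] := C_prim_root_exists m0.
apply/eqP; rewrite -leqn0 leqNgt (count_ge _ hz); apply/forallP => /(_ ord0) /eqP h0.
have [i0 _] : exists i0, i0 \in I by apply/card_gt0P; exact: ltnW.
have := mann_theorem (leqnn _) hz h0 (z ^+ (k`! * n i0)).
rewrite (bigD1 i0) //= big1 ?addr0 => [/eqP|i /andP[h1 h2]].
  rewrite bin0 mul1r expf_eq0 (prim_root_eq0 hz) => /andP[_ /eqP m1].
  by rewrite m1 in m0.
have nij : n i != n i0 by rewrite (inj_eq inj_n).
have K0 := fact_gt0 k; have ltK : (k`!.-1 < k`!)%N by rewrite prednK.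
have : (i, i0, Ordinal ltK) \in gap_divisors m.
  by rewrite inE (dvdn_gap_exponent _ hz nij) /= prednK.
by rewrite hS inE.
Qed.

Lemma profile_exists : exists p : {ffun {set X} -> 'I_k},
  p finset.set0 = 0%N :> nat /\ forall m, (0 < m)%N -> count_mem m s = p (gap_divisors m).
Proof.
pose N := (\max_(d <- s) d).+1.
(* By [count_mem_gap] all counts in the maximum agree; over an empty range it is 0. As [N] exceeds
   all entries of [s], no positive count is missed. *)
pose q (B : {set X}) := (\max_(m < N | (0 < m)%N && (gap_divisors m == B)) count_mem (val m) s)%N.
have q_lt B : (q B < k)%N.
  rewrite /q; elim/big_ind: _ => [|a b ha hb|m /andP[m0 _]]; first exact: ltnW.
  - by rewrite gtn_max ha hb.
  - exact: count_mem_lt.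
exists [ffun B => Ordinal (q_lt B)]; split=> [|m m0]; rewrite ffunE /=.
  apply/eqP; rewrite -leqn0; apply/bigmax_leqP => m /andP[m0 /eqP hm].
  by rewrite count_mem_gap0.
apply/eqP; rewrite eqn_leq; apply/andP; split; last first.
  apply/bigmax_leqP => m' /andP[m0' /eqP hm].
  by rewrite (count_mem_gap m0' m0).
have [ltN|leN] := ltnP m N.
  have := @leq_bigmax_cond _ (fun m' : 'I_N => (0 < m')%N && (gap_divisors m' == gap_divisors m))
     (fun m' => count_mem (val m') s) (Ordinal ltN); apply.
  by rewrite /= m0 eqxx.
suff /count_memPn -> : m \notin s by [].
apply: contraTN leN => ms; rewrite -ltnNge ltnS.
exact: (@leq_bigmax_seq _ s xpredT id).
Qed.

End Profile.

(** * From multiplicities to products of binomials *)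

Definition pos_part (x : int) : nat := if 0 <= x then `|x|%N else 0%N.
Definition neg_part (x : int) : nat := if 0 <= x then 0%N else `|x|%N.

Lemma pos_neg_part (x : int) : x = (pos_part x)%:Z - (neg_part x)%:Z.
Proof. by rewrite /pos_part /neg_part; case: ifP => h; lia. Qed.

Lemma Xn_sub1_prod (N c : nat) : (0 < c < N)%N ->
  'X^c - 1 = \prod_(1 <= d < N) 'Phi_d ^+ (d %| c)%N :> {poly int}.
Proof.
case/andP=> c0 cN; rewrite -(prod_Cyclotomic c0).
rewrite [RHS](eq_bigr (fun d => if (d %| c)%N then 'Phi_d else 1)); last first.
  by move=> d _; case: (d %| c)%N.
rewrite -[RHS]big_mkcond -[RHS]big_filter /=; apply: perm_big; apply: uniq_perm.
- exact: divisors_uniq.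
- by rewrite filter_uniq // iota_uniq.
move=> d; rewrite -dvdn_divisors // mem_filter mem_index_iota.
case: (boolP (d %| c)%N) => //= dc.
by rewrite (dvdn_gt0 c0 dc) (leq_ltn_trans (dvdn_leq c0 dc) cN).
Qed.

(** The bounds are asked only where [p t > 0]: the gcd over the empty set is 0, so a factor
    ['X^0 - 1 = 0] does occur, but with exponent 0. *)
Lemma prod_Xn_sub1_expr (T : finType) (c : T -> nat) (p : T -> nat) (N : nat) :
  (forall t, (0 < p t -> 0 < c t < N))%N ->
  \prod_t ('X^(c t) - 1) ^+ p t =
  \prod_(1 <= d < N) 'Phi_d ^+ (\sum_t p t * (d %| c t))%N :> {poly int}.
Proof.
move=> hc; under [RHS]eq_bigr do rewrite expr_sum.
rewrite exchange_big /=; apply: eq_bigr => t _.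
have [->|p0] := posnP (p t).
  by rewrite expr0 big1 // => d _; rewrite mul0n expr0.
rewrite (Xn_sub1_prod (hc t p0)) -prodrXl; apply: eq_bigr => d _.
by rewrite -exprM mulnC.
Qed.

Lemma prod_Cyclotomic_count (s : seq nat) (N : nat) :
  all (fun d => 0 < d < N)%N s ->
  \prod_(d <- s) 'Phi_d = \prod_(1 <= d < N) 'Phi_d ^+ count_mem d s.
Proof.
elim: s => [|m s IHs] /=.
  by move=> _; rewrite big_nil big1 // => d _; rewrite expr0.
case/andP=> hm /IHs IH; rewrite big_cons IH.
under [RHS]eq_bigr do rewrite exprD.
rewrite big_split /=; congr (_ * _).
rewrite (bigD1_seq m) ?iota_uniq ?mem_index_iota //=.
rewrite eqxx expr1 big1 ?mulr1 // => d; rewrite eq_sym => /negbTE ->.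
by rewrite expr0.
Qed.

Lemma biggcd_gap_exponent_gt0 (I : finType) (n : I -> nat) K (S : {set I * I * 'I_K}) :
  S != finset.set0 -> (0 < \big[gcdn/0]_(x in S) gap_exponent n x)%N.
Proof.
case/finset.set0Pn => x xS; rewrite lt0n; apply/eqP => c0.
have : (\big[gcdn/0]_(x in S) gap_exponent n x %| gap_exponent n x)%N.
  exact: (@biggcdn_inf _ x (mem S) _ _ xS (dvdnn _)).
by rewrite c0 dvd0n eqn0Ngt gap_exponent_gt0.
Qed.

(* A root of order m is a root of X^(c S) - 1 iff m divides all gaps in S. *)
Lemma cyclotomic_product_identity (I : finType) (n : I -> nat) (s : seq nat) (k : nat)
    (p : {set I * I * 'I_k`!} -> nat) (a : {set I * I * 'I_k`!} -> int) :
  all (leq 1) s ->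
  (forall m, (0 < m)%N -> count_mem m s = p [set x | m %| gap_exponent n x]%N) ->
  (forall B : {set I * I * 'I_k`!}, (p B)%:Z = \sum_(S : {set _} | S \subset B) a S) ->
  a finset.set0 = 0 ->
  let c (S : {set I * I * 'I_k`!}) := \big[gcdn/0%N]_(x in S) gap_exponent n x in
  \prod_(d <- s) 'Phi_d * \prod_S ('X^(c S) - 1) ^+ neg_part (a S) =
  \prod_S ('X^(c S) - 1) ^+ pos_part (a S) :> {poly int}.
Proof.
move=> s0 hp ha a0 c.
have c0 S : S != finset.set0 -> (0 < c S)%N by exact: biggcd_gap_exponent_gt0.
pose N := (\max_(d <- s) d + \max_S c S).+1.
have cN S : (c S < N)%N.
  by rewrite ltnS (leq_trans (leq_bigmax S)) // leq_addl.
have hN (q : int -> nat) : q 0 = 0%N -> forall S, (0 < q (a S))%N -> (0 < c S < N)%N.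
  by move=> q0 S hq; rewrite cN c0 //; apply: contraTneq hq => ->; rewrite a0 q0.
rewrite !(@prod_Xn_sub1_expr _ c _ N); try exact: hN.
rewrite (@prod_Cyclotomic_count s N); last first.
  apply/allP => d ds; rewrite (allP s0) //= ltnS (leq_trans _ (leq_addr _ _)) //.
  exact: (@leq_bigmax_seq _ s xpredT id).
rewrite -big_split /=; apply: eq_big_nat => d /andP[d0 _].
rewrite -exprD; congr (_ ^+ _).
(* These are the exponents of ['Phi_d]. A set [S] consists of gaps divisible by [d] exactly when [d]
   divides [c S], so [ha] gives the equality. *)
suff: Posz (count_mem d s + \sum_S neg_part (a S) * (d %| c S)) =
      Posz (\sum_S pos_part (a S) * (d %| c S)) by case.
rewrite PoszD !(big_morph Posz PoszD (erefl _)) hp // ha big_mkcond /= -big_split /=.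
apply: eq_bigr => S _.
have -> : (S \subset [set x | d %| gap_exponent n x]%N) = (d %| c S)%N.
  apply/fintype.subsetP/dvdn_biggcdP => h x xS; first by have := h x xS; rewrite inE.
  by rewrite inE h.
rewrite {1}[a S]pos_neg_part; case: (d %| c S)%N; rewrite /= ?muln1 ?muln0; lia.
Qed.

(** * Rigidity of products of binomials *)

(** The weights of the terms with a given exponent add up to 0 and [E'] is constant on these terms,
    so ['X^(E t)] may be replaced by any function of [E t] and [E' t]. This is the passage from one
    variable to two. *)
Lemma fiber_sum0 (T : finType) (E : T -> nat) (E' : T -> nat) (sg : T -> int)
    (A : nzRingType) (phi : nat -> nat -> A) :
  (forall t u, E t = E u -> E' t = E' u) ->
  \sum_t sg t *: 'X^(E t) = 0 :> {poly int} ->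
  \sum_t (sg t)%:~R * phi (E t) (E' t) = 0.
Proof.
move=> hE h0.
have hu u : \sum_(t | E t == u) sg t = 0.
  have := congr1 (fun q : {poly int} => q`_u) h0.
  rewrite coef0 coef_sum => e0; rewrite -[RHS]e0 big_mkcond; apply: eq_bigr => t _.
  by rewrite coefZ coefXn eq_sym; case: eqP; rewrite ?mulr1 ?mulr0.
pose N := (\max_t E t).+1.
have ltN t : (E t < N)%N by rewrite ltnS; exact: leq_bigmax.
rewrite (partition_big (fun t => Ordinal (ltN t)) xpredT) //= big1 // => u _.
have [/existsP [t0 /eqP ht0]|/existsPn hn] := boolP [exists t, Ordinal (ltN t) == u]; last first.
  by rewrite big1 // => t ht; have := hn t; rewrite ht.
rewrite (eq_bigr (fun t => (sg t)%:~R * phi (E t0) (E' t0))); last first.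
  move=> t /eqP ht; have e : E t = E t0 by have := congr1 val (etrans ht (esym ht0)).
  by rewrite e (hE _ _ e).
rewrite -mulr_suml -rmorph_sum /=.
suff -> : \sum_(t | Ordinal (ltN t) == u) sg t = 0 by rewrite mul0r.
by rewrite -[RHS](hu (val u)); apply: eq_bigl => t; rewrite -val_eqE.
Qed.

Lemma prodB_subsets (A : comNzRingType) (J : finType) (u v : J -> A) :
  \prod_j (u j - v j) =
  \sum_(S : {set J}) (-1) ^+ #|~: S| * ((\prod_(j in S) u j) * \prod_(j in ~: S) v j).
Proof.
rewrite (eq_bigr (fun j => u j + (- v j))) // bigA_distr; apply: eq_bigr => S _.
rewrite (bigID (mem S)) /= mulrCA; congr (_ * _).
  by apply: eq_bigr => j ->.
rewrite -prodrN; apply: eq_big => [j|j]; first by rewrite inE.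
by move=> /negbTE ->.
Qed.

Section Slope.
Variables (a b : nat).
(** The linear form on pairs [(x, x')] that vanishes in the direction [x' : x = a : b]. *)
Definition slope (x x' : nat) : int := b%:Z * x'%:Z - a%:Z * x%:Z.

Lemma slopeD x y x' y' : slope (x + y) (x' + y') = slope x x' + slope y y'.
Proof. rewrite /slope; lia. Qed.

Lemma slope_sum (J : finType) (S : {set J}) (c c' : J -> nat) :
  slope (\sum_(j in S) c j) (\sum_(j in S) c' j) = \sum_(j in S) slope (c j) (c' j).
Proof.
apply: (big_rec3 (fun x x' y => slope x x' = y)); first by rewrite /slope !mulr0.
by move=> j x x' y _ <-; rewrite slopeD.
Qed.

(* Y^x X^(slope x x') - 1, where X is the outer and Y the inner variable, up to a
   power of X that makes the exponents natural numbers. *)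
Definition slope_factor (x x' : nat) : {poly {poly int}} :=
  ('X^x)%:P * 'X^(pos_part (slope x x')) - 'X^(neg_part (slope x x')).

(** In the term of [S] the exponent of the outer variable is the slope of the partial sum over [S],
    shifted by the constant [neg] that makes it nonnegative. *)
Lemma prod_slope_factor (J : finType) (c c' : J -> nat) :
  let neg := (\sum_j neg_part (slope (c j) (c' j)))%N in
  \prod_j slope_factor (c j) (c' j) =
  \sum_(S : {set J}) (-1) ^+ #|~: S| *
    (('X^(\sum_(j in S) c j))%:P *
     'X^(absz (slope (\sum_(j in S) c j) (\sum_(j in S) c' j) + neg%:Z)%R)).
Proof.
move=> neg; rewrite prodB_subsets; apply: eq_bigr => S _; congr (_ * _).
rewrite big_split /= -mulrA; congr (_ * _).
  by rewrite -rmorph_prod /= -expr_sum.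
rewrite -!expr_sum -exprD; congr ('X^_).
suff : Posz (\sum_(j in S) pos_part (slope (c j) (c' j)) +
        \sum_(j in ~: S) neg_part (slope (c j) (c' j)))%N =
      slope (\sum_(j in S) c j) (\sum_(j in S) c' j) + neg%:Z by move=> <-.
have -> : neg = (\sum_(j in S) neg_part (slope (c j) (c' j)) +
    \sum_(j in ~: S) neg_part (slope (c j) (c' j)))%N.
  rewrite /neg (bigID (mem S)) /=; congr (_ + _)%N.
  by apply: eq_bigl => j; rewrite inE.
rewrite !PoszD addrA; congr (_ + _).
rewrite slope_sum !(big_morph Posz PoszD (erefl _)) -big_split /=.
apply: eq_bigr => j _; rewrite {2}[slope _ _]pos_neg_part; lia.
Qed.

Variables (I NT PT : finType) (n n' : I -> nat) (c c' : NT -> nat) (d d' : PT -> nat).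

(** Both sides of the identity are expanded over one index type, so that coincidences of exponents
    between the two sides are recorded as well. *)
Definition expansion (n : I -> nat) (c : NT -> nat) (d : PT -> nat)
    (t : I * {set NT} + {set PT}) : nat :=
  match t with
  | inl (i, J) => (n i + \sum_(j in J) c j)%N
  | inr J => (\sum_(j in J) d j)%N
  end.

Hypothesis identity :
  (\sum_i 'X^(n i)) * \prod_j ('X^(c j) - 1) = \prod_j ('X^(d j) - 1) :> {poly int}.
Hypothesis pattern : forall t u,
  expansion n c d t = expansion n c d u -> expansion n' c' d' t = expansion n' c' d' u.

Let sg (t : I * {set NT} + {set PT}) : int :=
  match t with inl (_, J) => (-1) ^+ #|~: J| | inr J => - (-1) ^+ #|~: J| end.

Let sg_sum (A : comNzRingType) (phi : nat -> nat -> A) :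
  \sum_t (sg t)%:~R * phi (expansion n c d t) (expansion n' c' d' t) =
  \sum_i \sum_(S : {set NT}) (-1) ^+ #|~: S| *
     phi (n i + \sum_(j in S) c j)%N (n' i + \sum_(j in S) c' j)%N
  - \sum_(S : {set PT}) (-1) ^+ #|~: S| * phi (\sum_(j in S) d j)%N (\sum_(j in S) d' j)%N.
Proof.
rewrite big_sumType /= -sumrN pair_big /=; congr (_ + _).
  by apply: eq_bigr => -[i S] _; rewrite rmorphXn rmorphN1.
by apply: eq_bigr => S _; rewrite rmorphN rmorphXn rmorphN1 mulNr.
Qed.

Lemma expansion_sum0 (A : comNzRingType) (phi : nat -> nat -> A) :
  \sum_i \sum_(S : {set NT}) (-1) ^+ #|~: S| *
     phi (n i + \sum_(j in S) c j)%N (n' i + \sum_(j in S) c' j)%N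
  = \sum_(S : {set PT}) (-1) ^+ #|~: S| * phi (\sum_(j in S) d j)%N (\sum_(j in S) d' j)%N.
Proof.
apply/eqP; rewrite -subr_eq0 -sg_sum; apply/eqP.
apply: fiber_sum0 pattern _.
(* The choice of [phi] that ignores its second argument gives back [identity]. *)
have := sg_sum (fun x _ => 'X^x : {poly int}).
under eq_bigr => t _ do rewrite mulrzl -scaler_int intz.
move=> ->; apply/eqP; rewrite subr_eq0; apply/eqP.
have expand (J : finType) (e : J -> nat) :
    \prod_j ('X^(e j) - 1) = \sum_(S : {set J}) (-1) ^+ #|~: S| * 'X^(\sum_(j in S) e j) :> {poly int}.
  rewrite prodB_subsets; apply: eq_bigr => S _.
  by rewrite big1_eq mulr1 -expr_sum.
rewrite -expand -identity expand mulr_suml; apply: eq_bigr => i _.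
by rewrite mulr_sumr; apply: eq_bigr => S _; rewrite mulrCA -exprD.
Qed.

(** This is [expansion_sum0] for [phi x x' = Y^x X^(slope x x' + M)]; the powers ['X^p] and ['X^q]
    absorb the shifts. When [L] is the least slope, the constant coefficient in [X] of the sum over
    [i] is the sum over a face. *)
Lemma slope_identity (L : int) : (forall i, L <= slope (n i) (n' i)) ->
  exists p q : nat,
  'X^p * ((\sum_i ('X^(n i))%:P * 'X^(absz (slope (n i) (n' i) - L)%R)) *
          \prod_j slope_factor (c j) (c' j)) =
  'X^q * \prod_j slope_factor (d j) (d' j).
Proof.
move=> hL.
pose negN := (\sum_j neg_part (slope (c j) (c' j)))%N.
pose negP := (\sum_j neg_part (slope (d j) (d' j)))%N.
(* Large enough for all exponents below, including [M + L - negN] and [M - negP], to be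
   nonnegative. *)
pose M := negN%:Z + negP%:Z + `|L|.
exists (absz (M + L - negN%:Z)%R), (absz (M - negP%:Z)%R).
have neg_le (J : finType) (e e' : J -> nat) (S : {set J}) :
    0 <= slope (\sum_(j in S) e j) (\sum_(j in S) e' j) +
         Posz (\sum_j neg_part (slope (e j) (e' j)))%N.
  rewrite slope_sum [X in Posz X](bigID (mem S)) /= PoszD addrA addr_ge0 //.
  rewrite (big_morph Posz PoszD (erefl _)) -big_split sumr_ge0 //= => j _.
  rewrite {1}[slope _ _]pos_neg_part; lia.
have := expansion_sum0 (fun x x' => ('X^x)%:P * 'X^(absz (slope x x' + M)%R) : {poly {poly int}}).
rewrite !prod_slope_factor -/negN -/negP => e0.
transitivity (\sum_(S : {set PT}) (-1) ^+ #|~: S| *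
  (('X^(\sum_(j in S) d j))%:P *
   'X^(absz (slope (\sum_(j in S) d j) (\sum_(j in S) d' j) + M)%R)) : {poly {poly int}}).
  rewrite -e0 mulr_suml mulr_sumr; apply: eq_bigr => i _.
  rewrite !mulr_sumr; apply: eq_bigr => S _.
  rewrite slopeD exprD rmorphM /=.
  have -> : (absz (slope (n i) (n' i) + slope (\sum_(j in S) c j) (\sum_(j in S) c' j) + M)%R) =
    (absz (M + L - negN%:Z)%R + (absz (slope (n i) (n' i) - L)%R +
     absz (slope (\sum_(j in S) c j) (\sum_(j in S) c' j) + negN%:Z)%R))%N.
    have := neg_le _ c c' S; have := hL i; rewrite -/negN /M.
    move: (slope (n i) (n' i)) (slope (\sum_(j in S) c j) (\sum_(j in S) c' j)).
    move: (negN) (negP) => x y u v; lia.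
  by rewrite !exprD; ring.
rewrite mulr_sumr; apply: eq_bigr => S _.
have -> : (absz (slope (\sum_(j in S) d j) (\sum_(j in S) d' j) + M)%R) =
    (absz (M - negP%:Z)%R +
     absz (slope (\sum_(j in S) d j) (\sum_(j in S) d' j) + negP%:Z)%R)%N.
  have := neg_le _ d d' S; rewrite -/negP /M.
  move: (slope (\sum_(j in S) d j) (\sum_(j in S) d' j)).
  move: (negN) (negP) => x y v; lia.
by rewrite !exprD; ring.
Qed.

End Slope.

(** What a factor off the direction leaves at lowest order: a sign or a monomial, with value 1 or -1
    at 1. *)
Definition slope_unit (a b x x' : nat) : {poly int} :=
  if slope a b x x' == 0 then 1 else if 0 < slope a b x x' then -1 else 'X^x.

Lemma slope_factor0 a b x x' :
  (slope_factor a b x x').[0] =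
  (if slope a b x x' == 0 then 'X^x - 1 else 1) * slope_unit a b x x'.
Proof.
rewrite /slope_factor /slope_unit hornerD hornerN hornerCM !hornerXn /pos_part /neg_part.
case: (ltrgtP (slope a b x x') 0) => h.
- rewrite expr0 mulr1 expr0n; case: eqP => h'; first by lia.
  by rewrite subr0 mul1r.
- rewrite expr0 expr0n; case: eqP => h'; first by lia.
  by rewrite mulr0 sub0r mul1r.
by rewrite h expr0n /= !mulr1.
Qed.

Lemma slope_unit1 a b x x' : (slope_unit a b x x').[1] ^+ 2 = 1.
Proof.
rewrite /slope_unit; case: ifP => _; first by rewrite hornerC expr1n.
by case: ifP => _; rewrite ?hornerN ?hornerC ?sqrrN ?hornerXn !expr1n.
Qed.

Lemma slope_factor0_neq0 a b x x' : (0 < x)%N -> (slope_factor a b x x').[0] != 0.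
Proof.
move=> x0; rewrite slope_factor0 mulf_neq0 //.
  case: ifP => _; rewrite ?oner_neq0 // -size_poly_eq0.
  by rewrite size_XnsubC.
by apply/eqP => u0; have := slope_unit1 a b x x'; rewrite u0 horner0 expr0n.
Qed.

Section Rigidity.
Variables (I NT PT : finType) (n n' : I -> nat) (c c' : NT -> nat) (d d' : PT -> nat).
Hypothesis identity :
  (\sum_i 'X^(n i)) * \prod_j ('X^(c j) - 1) = \prod_j ('X^(d j) - 1) :> {poly int}.
Hypothesis pattern : forall t u,
  expansion n c d t = expansion n c d u -> expansion n' c' d' t = expansion n' c' d' u.
Hypotheses (c_gt0 : forall j, (0 < c j)%N) (d_gt0 : forall j, (0 < d j)%N).

(* Lowest coefficient in the outer variable of the identity [slope_identity]. *)
Lemma face_identity a b (i0 : I) : exists E : {set I},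
  [/\ (0 < #|E|)%N,
      forall i j, i \in E -> j \in E -> slope a b (n i) (n' i) = slope a b (n j) (n' j) &
      (\sum_(i in E) 'X^(n i)) * \prod_j (slope_factor a b (c j) (c' j)).[0] =
      \prod_j (slope_factor a b (d j) (d' j)).[0]].
Proof.
pose l i := slope a b (n i) (n' i).
case: (arg_minP l (isT : xpredT i0)) => i1 _ hi1.
exists [set i | l i == l i1]; split.
- by apply/card_gt0P; exists i1; rewrite inE.
- by move=> i j; rewrite !inE /l => /eqP -> /eqP ->.
have hL i : l i1 <= l i by exact: hi1.
have [p [q]] := slope_identity identity pattern hL.
set f := \sum_i _; set N := \prod_j slope_factor _ _ (c j) _.
set P := \prod_j slope_factor _ _ (d j) _ => e.
have f0 : f.[0] = \sum_(i in [set i | l i == l i1]) 'X^(n i).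
  rewrite horner_sum [RHS]big_mkcond; apply: eq_bigr => i _.
  rewrite hornerCM hornerXn expr0n inE /l absz_eq0 subr_eq0.
  by case: ifP; rewrite ?mulr1 ?mulr0.
have N0 : N.[0] = \prod_j (slope_factor a b (c j) (c' j)).[0].
  by rewrite horner_prod.
have P0 : P.[0] = \prod_j (slope_factor a b (d j) (d' j)).[0].
  by rewrite horner_prod.
rewrite -f0 -N0 -P0 -hornerM.
have nzP : P.[0] != 0.
  by rewrite P0; apply/prodf_neq0 => j _; exact: slope_factor0_neq0.
have nzfN : (f * N).[0] != 0.
  rewrite hornerM mulf_neq0 //; last first.
    by rewrite N0; apply/prodf_neq0 => j _; exact: slope_factor0_neq0.
  rewrite f0; apply/eqP => /(congr1 (horner^~ 1)) /eqP.
  rewrite horner0 horner_sum (eq_bigr (fun=> 1)); last first.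
    by move=> i _; rewrite hornerXn expr1n.
  rewrite sumr_const -[1 *+ _]/(_%:R) pnatr_eq0 => /eqP h.
  have : i1 \in [set i | l i == l i1] by rewrite inE.
  by rewrite (cards0_eq h) inE.
(* Both sides have nonzero constant coefficients once the powers of ['X] are removed, so these
   powers agree and cancel. *)
have key u v (A B : {poly {poly int}}) : (u <= v)%N -> 'X^u * A = 'X^v * B ->
    A.[0] != 0 -> A = B.
  move=> uv; rewrite -(subnKC uv) exprD -mulrA => /(mulfI (monic_neq0 (monicXn _ _))) ->.
  rewrite hornerM hornerXn expr0n; case: (v - u)%N => [|w] /=.
    by rewrite expr0 mul1r.
  by rewrite mul0r eqxx.
have [pq|/ltnW qp] := leqP p q; first by rewrite (key _ _ _ _ pq e).
by rewrite (key _ _ _ _ qp (esym e)).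
Qed.

(** The face identities are multiplied over one representative of each direction. Every binomial
    then appears exactly once, in its own direction, and [identity] cancels them all: up to signs
    and monomials the product of the face sums is the full sum. At 1 this reads
    [prod #|E v| = #|I|], so the prime [#|I|] divides some [#|E v|] and that face is everything. Its
    constant slope is 0, the value at [i0]. *)
Lemma rigidity (i0 : I) : prime #|I| -> n i0 = 0%N -> n' i0 = 0%N ->
  (forall j, (0 < c' j)%N) -> (forall j, (0 < d' j)%N) ->
  exists a b : nat, [/\ (0 < a)%N, (0 < b)%N & forall i, (b * n' i = a * n i)%N].
Proof.
move=> pI ni0 ni0' c'0 d'0.
pose Z := (NT + PT)%type.
pose C (z : Z) := match z with inl j => c j | inr j => d j end.
pose C' (z : Z) := match z with inl j => c' j | inr j => d' j end.
have C0 z : (0 < C z)%N by case: z => j /=.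
have C'0 z : (0 < C' z)%N by case: z => j /=.
pose sim z y := (C z * C' y == C' z * C y)%N.
have simE z y : sim z y -> sim z =1 sim y.
  move=> /eqP h x; rewrite /sim.
  rewrite -(eqn_pmul2l (C'0 y)) -[RHS](eqn_pmul2l (C'0 z)).
  have -> : (C' y * (C z * C' x) = C' z * (C y * C' x))%N.
    by rewrite mulnCA mulnA h mulnA.
  by rewrite [(C' y * (C' z * _))%N]mulnCA.
have simxx z : sim z z by rewrite /sim mulnC.
(* Equivalent elements have the same predicate [sim z], so [pick] selects the same representative
   for them. *)
pose rep z := odflt z [pick y | sim z y].
have sim_rep z : sim (rep z) z.
  rewrite /rep; case: pickP => [y hy|/(_ z)]; last by rewrite simxx.
  by rewrite /= -(simE _ _ hy).
have rep_eq z y : (rep z == y) = (y \in [set rep z | z : Z]) && sim y z.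
  apply/eqP/andP => [<-|[/imsetP [x _ ->] h]].
    by split=> //; apply/imsetP; exists z.
  have e : sim z =1 sim x.
    by move=> u; rewrite -(simE _ _ h) (simE _ _ (sim_rep x)).
  rewrite /rep (eq_pick e); case: pickP => // /(_ x); by rewrite simxx.
pose reps := [set rep z | z : Z].
have slope_sim v z : (slope (C' v) (C v) (C z) (C' z) == 0) = sim v z.
  by rewrite /slope subr_eq0 -!PoszM eqz_nat.
have prod_sim (G : Z -> {poly int}) z :
    \prod_(v in reps) (if slope (C' v) (C v) (C z) (C' z) == 0 then G z else 1) = G z.
  rewrite -big_mkcondr /= (big_pred1 (rep z)) // => v /=.
  by rewrite slope_sim eq_sym rep_eq.
have [E hE] := fin_all_exists (fun v : Z => face_identity (C' v) (C v) i0).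
pose UN := \prod_j \prod_(v in reps) slope_unit (C' v) (C v) (c j) (c' j).
pose UP := \prod_j \prod_(v in reps) slope_unit (C' v) (C v) (d j) (d' j).
have faces : (\prod_(v in reps) \sum_(i in E v) 'X^(n i)) * UN = (\sum_i 'X^(n i)) * UP.
  have nz : \prod_j ('X^(c j) - 1) != 0 :> {poly int}.
    by apply/prodf_neq0 => j _; rewrite monic_neq0 // monicXnsubC.
  apply: (mulIf nz); rewrite [RHS]mulrAC identity.
  have eE : \prod_(v in reps) ((\sum_(i in E v) 'X^(n i)) *
        \prod_j (slope_factor (C' v) (C v) (c j) (c' j)).[0]) =
      \prod_(v in reps) \prod_j (slope_factor (C' v) (C v) (d j) (d' j)).[0].
    by apply: eq_bigr => v _; case: (hE v).
  have splitU (J : finType) (x x' : J -> nat) (inj : J -> Z) :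
      (forall j, C (inj j) = x j) -> (forall j, C' (inj j) = x' j) ->
      \prod_(v in reps) \prod_j (slope_factor (C' v) (C v) (x j) (x' j)).[0] =
      (\prod_j ('X^(x j) - 1)) *
      \prod_j \prod_(v in reps) slope_unit (C' v) (C v) (x j) (x' j).
    move=> he he'; rewrite exchange_big -big_split; apply: eq_bigr => j _ /=.
    rewrite -(he j) -(he' j) -[in RHS](prod_sim (fun z => 'X^(C z) - 1)) -big_split.
    by apply: eq_bigr => v _ /=; rewrite slope_factor0.
  have eN := splitU NT c c' inl (fun=> erefl) (fun=> erefl).
  have eP := splitU PT d d' inr (fun=> erefl) (fun=> erefl).
  move: eE; rewrite big_split /= eN eP -/UN -/UP => e.
  by rewrite -e mulrAC mulrA.
(* The units are 1 or -1 at 1; squaring removes the sign, which is harmless because cardinalities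
   are nonnegative. *)
have one (J : finType) (e e' : J -> nat) :
    (\prod_j \prod_(v in reps) slope_unit (C' v) (C v) (e j) (e' j)).[1] ^+ 2 = 1.
  rewrite horner_prod -prodrXl big1 // => j _.
  by rewrite horner_prod -prodrXl big1 // => v _; exact: slope_unit1.
have cardE : (\prod_(v in reps) #|E v| = #|I|)%N.
  have := congr1 (fun q : {poly int} => q.[1] ^+ 2) faces.
  rewrite !hornerM !exprMn (one _ c c') (one _ d d') !mulr1.
  have sum1 (A : {set I}) : (\sum_(i in A) 'X^(n i) : {poly int}).[1] = #|A|%:Z.
    rewrite horner_sum (eq_bigr (fun=> 1)) => [|i _]; last by rewrite hornerXn expr1n.
    by rewrite sumr_const natz.
  rewrite horner_prod (eq_bigr (fun v => #|E v|%:Z)) => [|v _]; last exact: sum1.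
  have -> : \sum_i 'X^(n i) = \sum_(i in [set: I]) 'X^(n i) :> {poly int}.
    by apply: eq_bigl => i; rewrite inE.
  rewrite sum1 cardsT -(big_morph Posz PoszM (erefl _)) => /eqP.
  by rewrite eqf_sqr => /orP[]/eqP; lia.
have := dvdnn #|I|; rewrite -[in X in (_ %| X)%N]cardE Euclid_dvd_prod // big_has_cond.
case/hasP => v _ /andP[vr dv].
have [E0 hs _] := hE v.
have ET : E v = [set: I].
  apply/eqP; rewrite eqEcard finset.subsetT cardsT /=; exact: dvdn_leq.
exists (C' v), (C v); split=> // i.
have := hs i i0; rewrite ET !inE ni0 ni0' /slope => /(_ isT isT); lia.
Qed.
End Rigidity.

(** * Kronecker's theorem *)

Lemma nat_pigeonhole (T : finType) (h : nat -> T) : exists i j, (i < j)%N /\ h i = h j.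
Proof.
have : ~~ injectiveb (fun i : 'I_#|T|.+1 => h i).
  apply/negP => /injectiveP /leq_card; rewrite card_ord; by rewrite ltnn.
case/injectivePn => i [j ij hij]; case: (ltngtP i j) => lt.
- by exists i, j.
- by exists j, i.
by move: ij; rewrite (val_inj lt) eqxx.
Qed.

(* The monic polynomial whose roots are the squares of the roots of p. *)
Definition graeffe (A : nzRingType) (p : {poly A}) : {poly A} :=
  (-1) ^+ (size p).-1 *: (even_poly p ^+ 2 - 'X * odd_poly p ^+ 2).

Lemma graeffe_map (A : nzRingType) (B : nzRingType) (f : {rmorphism A -> B}) (p : {poly A}) :
  p \is monic -> map_poly f (graeffe p) = graeffe (map_poly f p).
Proof.
move=> mp; rewrite /graeffe map_polyZ rmorphXn rmorphN1.
have -> : size (map_poly f p) = size p.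
  by rewrite size_map_poly_id0 // (monicP mp) rmorph1 oner_neq0.
congr (_ *: _); rewrite rmorphB rmorphXn [X in _ - X]rmorphM rmorphXn /= map_polyX.
congr (_ ^+ 2 - 'X * _ ^+ 2); apply/polyP => i.
  by rewrite coef_map !coef_even_poly coef_map.
by rewrite coef_map !coef_odd_poly coef_map.
Qed.

(** With [p = E(X^2) + X O(X^2)], substituting [X^2] into [E^2 - X O^2] gives [p(X) p(-X)], which
    is, up to sign, the product of the [X^2 - x^2]. *)
Lemma graeffe_prod (A : comNzRingType) (rs : seq A) :
  graeffe (\prod_(x <- rs) ('X - x%:P)) = \prod_(x <- rs) ('X - (x ^+ 2)%:P).
Proof.
set p := \prod_(x <- rs) _; set q := RHS.
suff e : graeffe p \Po 'X^2 = q \Po 'X^2.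
  apply/polyP => i; have := congr1 (fun r : {poly A} => r`_(i * 2)) e.
  by rewrite !coef_comp_poly_Xn // dvdn_mull // mulnK.
have eo := poly_even_odd p.
have pX : p \Po (- 'X) = (even_poly p \Po 'X^2) - (odd_poly p \Po 'X^2) * 'X.
  rewrite -{1}eo comp_polyD comp_polyM comp_polyX -!comp_polyA comp_Xn_poly sqrrN.
  by rewrite mulrN.
have -> : graeffe p \Po 'X^2 = (-1) ^+ size rs *: (p * (p \Po (- 'X))).
  have cX (r : {poly A}) : (r ^+ 2) \Po 'X^2 = (r \Po 'X^2) ^+ 2.
    by rewrite expr2 comp_polyM.
  rewrite /graeffe comp_polyZ comp_polyB cX [X in _ - X]comp_polyM cX comp_polyX.
  rewrite {1}/p size_prod_XsubC /= pX; congr (_ *: _).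
  by rewrite -[X in _ = X * _]eo; ring.
rewrite /p /q !rmorph_prod /= -big_split /=.
elim: rs {p q eo pX} => [|x rs IHs] /=; first by rewrite !big_nil scale1r.
rewrite !big_cons -IHs exprS -scalerA -!scalerAr scaleN1r -scalerN -mulNr; congr (_ *: (_ * _)).
by rewrite !comp_polyB !comp_polyX !comp_polyC rmorphXn /=; ring.
Qed.

Lemma norm_coef_prod_XsubC (C : numDomainType) (rs : seq C) (i : nat) :
  all (fun x => `|x| <= 1) rs ->
  `|(\prod_(x <- rs) ('X - x%:P))`_i| <= (2 ^ size rs)%:R.
Proof.
elim: rs i => [|x rs IHs] i /=.
  by move=> _; rewrite big_nil coef1; case: eqP; rewrite ?normr1 ?normr0 ?ler01.
case/andP=> hx hrs; rewrite big_cons mulrBl coefB mulrC coefMX coefCM expnS mul2n -addnn natrD.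
apply: le_trans (ler_normB _ _) _; apply: lerD.
  by case: eqP => _; [rewrite normr0 ler0n | exact: IHs].
by rewrite normrM (le_trans _ (IHs i hrs)) // ler_piMl.
Qed.

Lemma map_iter_graeffe (C : numFieldType) (f : {poly int}) (rs : seq C) (j : nat) :
  map_poly intr f = \prod_(x <- rs) ('X - x%:P) -> f \is monic ->
  map_poly intr (iter j (@graeffe _) f) = \prod_(x <- rs) ('X - (x ^+ (2 ^ j))%:P).
Proof.
move=> hf mf.
suff [] : map_poly intr (iter j (@graeffe _) f) = \prod_(x <- rs) ('X - (x ^+ (2 ^ j))%:P)
   /\ iter j (@graeffe _) f \is monic by [].
elim: j => [|j [IHj mj]] /=.
  by split=> //; rewrite hf; apply: eq_bigr => x _; rewrite expr1.
set F := iter j _ f in IHj mj *.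
have e : map_poly intr (graeffe F) = \prod_(x <- rs) ('X - (x ^+ (2 ^ j.+1))%:P) :> {poly C}.
  rewrite graeffe_map // IHj -(big_map (fun x : C => x ^+ (2 ^ j)) xpredT (fun x => 'X - x%:P)).
  rewrite graeffe_prod big_map; apply: eq_bigr => x _.
  by rewrite -exprM expnS mulnC.
split=> //; rewrite monicE -(inj_eq (@intr_inj C)) -lead_coef_map_inj //; last exact: intr_inj.
by rewrite e (monicP (monic_prod_XsubC _ _ _)).
Qed.

(** The iterates of [graeffe] have bounded degrees and bounded integer coefficients, so two of them,
    of indices [i < j], coincide. Hence the set [A] of the [2^i]-th powers of the roots is stable
    under the power [Q = 2^(j-i)]; the orbit of [x ^+ (2 ^ i)] in this finite set repeats, and
    [x != 0]. *)
Lemma kronecker_root (C : numClosedFieldType) (f : {poly int}) (x : C) :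
  f \is monic -> f.[0] != 0 ->
  (forall y : C, root (map_poly intr f) y -> `|y| <= 1) ->
  root (map_poly intr f) x -> exists2 N, (0 < N)%N & x ^+ N = 1.
Proof.
move=> mf f0 hroots hx.
have [rs] := closed_field_poly_normal (map_poly (intr : int -> C) f).
rewrite lead_coef_map_inj ?(monicP mf) ?rmorph1 ?scale1r //; last exact: intr_inj.
move=> hf.
have rsP y : (y \in rs) = root (map_poly intr f) y by rewrite hf root_prod_XsubC.
pose B := (2 ^ size rs)%N; pose n := (size rs).+1.
pose F j := iter j (@graeffe _) f.
have hF j := map_iter_graeffe j hf mf.
have small j : all (fun y => `|y| <= 1) [seq y ^+ (2 ^ j) | y <- rs].
  apply/allP => _ /mapP [y ys ->]; rewrite normrX exprn_ile1 //.
  by apply: hroots; rewrite -rsP.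
have coefF j i : (absz ((F j)`_i)%R <= B)%N.
  rewrite -(ler_nat C) natr_absz intr_norm.
  have := norm_coef_prod_XsubC i (small j).
  by rewrite size_map big_map -hF coef_map.
have sizeF j : (size (F j) <= n)%N.
  rewrite -(size_map_inj_poly (@intr_inj C)) ?rmorph0 // hF.
  by rewrite -(big_map (fun x : C => x ^+ (2 ^ j)) xpredT (fun x => 'X - x%:P)) size_prod_XsubC size_map.
(* Coefficients lie between [-B] and [B]; adding [B] makes them elements of an ordinal. *)
pose code j : {ffun 'I_n -> 'I_(2 * B).+1} := [ffun i : 'I_n => inord (absz ((F j)`_i + B%:Z)%R)].
have [i [j [ltij eij]]] := nat_pigeonhole code.
have FF : F i = F j.
  apply/polyP => u; have [ltu|leu] := ltnP u n; last first.
    by rewrite !nth_default // (leq_trans (sizeF _)).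
  have := congr1 (fun g : {ffun 'I_n -> 'I_(2 * B).+1} => val (g (Ordinal ltu))) eij.
  have := coefF i u; have := coefF j u; rewrite !ffunE /= => h1 h2.
  by rewrite !inordK; lia.
pose Q := (2 ^ (j - i))%N.
pose A := [seq y ^+ (2 ^ i) | y <- rs].
have AQ y : y \in A -> y ^+ Q \in A.
  case/mapP => z zs ->; rewrite -exprM -expnD subnKC ?(ltnW ltij) //.
  have e : A =i [seq y ^+ (2 ^ j) | y <- rs].
    move=> w; have := congr1 (fun p : {poly int} => root (map_poly intr p) w) FF.
    rewrite /F !hF.
    rewrite -!(big_map (fun x : C => x ^+ (2 ^ _)) xpredT (fun x => 'X - x%:P)).
    by rewrite !root_prod_XsubC.
  by rewrite e; apply: map_f.
have xA t : (x ^+ (2 ^ i)) ^+ (Q ^ t) \in A.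
  elim: t => [|t IHt]; first by rewrite expn0 expr1; apply/mapP; exists x; rewrite ?rsP.
  by rewrite expnSr exprM AQ.
have szA t : (index ((x ^+ (2 ^ i)) ^+ (Q ^ t)) A < size A)%N by rewrite index_mem.
have [t [u [lttu /(congr1 val) /= etu]]] := nat_pigeonhole (fun t => Ordinal (szA t)).
have {}etu : (x ^+ (2 ^ i)) ^+ (Q ^ t) = (x ^+ (2 ^ i)) ^+ (Q ^ u).
  by rewrite -[LHS](nth_index 0 (xA t)) etu nth_index.
have x0 : x != 0.
  apply: contraNneq f0 => x0; move: hx.
  by rewrite x0 rootE !horner_coef0 coef_map /= intr_eq0.
have Q1 : (1 < Q)%N by rewrite /Q -{1}(expn0 2) ltn_exp2l // subn_gt0.
have ltQ : (Q ^ t < Q ^ u)%N by rewrite ltn_exp2l.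
exists (2 ^ i * (Q ^ u - Q ^ t))%N; first by rewrite muln_gt0 expn_gt0 subn_gt0.
apply: (mulfI (expf_neq0 (2 ^ i * Q ^ t)%N x0)).
by rewrite mulr1 -exprD -mulnDr subnKC ?(ltnW ltQ) // !exprM etu.
Qed.

(** As a root of [X^m - 1], [x] is a root of some ['Phi_d] with [d] dividing [m]; then [x ^+ d = 1],
    so [m] divides [d]. *)
Lemma Cyclotomic_root (C : numClosedFieldType) m (x : C) :
  m.-primitive_root x -> root (map_poly intr 'Phi_m) x.
Proof.
move=> hx; have m0 := prim_order_gt0 hx.
have root1 d : root (map_poly (intr : int -> C) 'Phi_d) x -> (0 < d)%N -> (m %| d)%N.
  move=> hd d0; rewrite (prim_order_dvd hx) -subr_eq0.
  have : root (map_poly (intr : int -> C) ('X^d - 1)) x.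
    rewrite -prod_Cyclotomic // (big_rem d) -?dvdn_divisors //= rmorphM /=.
    by rewrite rootM hd.
  by rewrite rmorphB rmorph1 /= map_polyXn rootE !hornerE.
have : root (map_poly (intr : int -> C) (\prod_(d <- divisors m) 'Phi_d)) x.
  rewrite prod_Cyclotomic // rmorphB rmorph1 /= map_polyXn rootE !hornerE.
  by rewrite (prim_expr_order hx) subrr.
rewrite rmorph_prod /= rootE horner_prod prodf_seq_eq0 => /hasP[d].
rewrite -dvdn_divisors //= => dm hd.
have d0 := dvdn_gt0 m0 dm.
suff <- : d = m by [].
by apply/eqP; rewrite eqn_dvd dm root1.
Qed.

(** The remainder [r] of [f] modulo ['Phi_m] shares the root [x] with ['Phi_m], so the two are not
    coprime over the rationals and have a common root [w] in [algC]. The minimal polynomial of [w]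
    is ['Phi_m], which thus divides [r]; as [r] has smaller degree, it is 0. *)
Lemma Cyclotomic_dvd (C : numClosedFieldType) m (x : C) (f : {poly int}) :
  m.-primitive_root x -> root (map_poly intr f) x -> exists g, f = g * 'Phi_m.
Proof.
move=> hx hf; have mP := Cyclotomic_monic m.
have := Pdiv.RingMonic.rdivp_eq mP f.
set g := Pdiv.Ring.rdivp _ _; set r := Pdiv.Ring.rmodp _ _ => fE.
exists g; suff r0 : r = 0 by rewrite {1}fE r0 addr0.
have sr : (size r < size 'Phi_m)%N by rewrite Pdiv.Ring.ltn_rmodp monic_neq0.
have rx : root (map_poly (intr : int -> C) r) x.
  move: hf; rewrite fE rmorphD rmorphM /= !rootE hornerD hornerM.
  by have /rootP -> := Cyclotomic_root hx; rewrite mulr0 add0r.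
have [z hz] := C_prim_root_exists (prim_order_gt0 hx).
pose rQ : {poly rat} := map_poly intr r; pose PQ : {poly rat} := map_poly intr 'Phi_m.
have nco : ~~ coprimep rQ PQ.
  apply/negP; rewrite -(coprimep_map (ratr : rat -> C)) -!map_poly_intr_ratr => /coprimep_root.
  move=> /(_ x rx); by have /rootP -> := Cyclotomic_root hx; rewrite eqxx.
have : ~~ coprimep (map_poly (ratr : rat -> algC) rQ) (map_poly ratr PQ).
  by rewrite coprimep_map.
rewrite -!map_poly_intr_ratr => nco'.
have [w rw Pw] : exists2 w : algC, root (map_poly intr r) w & root (map_poly intr 'Phi_m) w.
  apply: contrapT => H; case/negP: nco'; apply: Pdiv.ClosedField.root_coprimep => w rw.
  by apply/negP => Pw; apply: H; exists w.
have hw : m.-primitive_root w.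
  by rewrite -(root_cyclotomic hz) -(Cintr_Cyclotomic hz).
have [q [Dq _] dv] := minCpolyP w.
have qP : q = PQ.
  apply: (@map_poly_inj _ _ (@ratr algC)); rewrite -Dq -map_poly_intr_ratr.
  by rewrite (minCpoly_cyclotomic hw) (Cintr_Cyclotomic hw).
move: rw; rewrite map_poly_intr_ratr dv qP => /dvdp_leq h.
apply/eqP/contraT => r0.
have : (size PQ <= size rQ)%N.
  by apply: h; rewrite map_poly_eq0_id0 //; rewrite ?intr_eq0 ?lead_coef_eq0.
rewrite !size_map_inj_poly ?rmorph0 //; try exact: intr_inj.
by rewrite leqNgt sr.
Qed.

Lemma prod_Cyclotomic_of_roots (C : numClosedFieldType) (f : {poly int}) :
  f \is monic ->
  (forall x : C, root (map_poly intr f) x -> exists2 N, (0 < N)%N & x ^+ N = 1) ->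
  exists2 s : seq nat, all (leq 1) s & f = \prod_(d <- s) 'Phi_d.
Proof.
move: {2}(size f) (leqnn (size f)) => N; elim: N f => [|N IHN] f.
  by rewrite leqn0 size_poly_eq0 => /eqP -> /monic_neq0; rewrite eqxx.
move=> sf mf hroots.
have [f1|f1] := leqP (size f) 1.
  exists [::] => //; rewrite big_nil; have := mf; rewrite (size1_polyC f1).
  by rewrite monicE lead_coefC => /eqP ->.
have /closed_rootP [x hx] : size (map_poly (intr : int -> C) f) != 1%N.
  rewrite size_map_inj_poly ?rmorph0 //; last exact: intr_inj.
  by rewrite gtn_eqF.
have [M M0 xM] := hroots x hx.
have [m hm _] := prim_order_exists M0 xM.
have [g fg] := Cyclotomic_dvd hm hx.
have mP := Cyclotomic_monic m.
have mg : g \is monic by move: mf; rewrite fg monicMr.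
have sP : (1 < size 'Phi_m)%N.
  by rewrite size_Cyclotomic ltnS totient_gt0 (prim_order_gt0 hm).
have [s s0 gs] : exists2 s : seq nat, all (leq 1) s & g = \prod_(d <- s) 'Phi_d.
  apply: IHN => //; last first.
    by move=> y hy; apply: hroots; rewrite fg rmorphM /= rootM hy.
  rewrite -ltnS; apply: leq_trans sf; rewrite fg size_Mmonic ?monic_neq0 //.
  by move: sP; case: (size 'Phi_m) => [|[|u]] // _; rewrite addnS /= addnS ltnS leq_addr.
exists (m :: s); first by rewrite /= (prim_order_gt0 hm).
by rewrite big_cons fg gs mulrC.
Qed.

Local Open Scope classical_set_scope.
Local Open Scope ring_scope.
Local Open Scope complex_scope.

(** * Jensen's formula *)

Section HalfScaling.
Context {R : realType}.
Local Notation mu := (@lebesgue_measure R).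
Variable s : R.

Let phi (t : R) : measurableTypeR R := (t + s) / 2.

Let mphi : measurable_fun [set: measurableTypeR R] phi.
Proof.
by apply: measurable_funM => //; apply: measurable_funD.
Qed.

Let phi_preimage (b c : bool) (x y : R) :
  phi @^-1` [set` Interval (BSide b x) (BSide c y)] =
  [set` Interval (BSide b (2 * x - s)) (BSide c (2 * y - s))].
Proof.
apply/seteqP; split => t /=; rewrite !in_itv /= /phi; case: b; case: c => /=; lra.
Qed.

Let push : {measure set (measurableTypeR R) -> \bar R}.
Proof. by refine (pushforward mu phi : {measure set _ -> \bar R}). Defined.

(** By uniqueness of Lebesgue measure it suffices to compare on intervals, whose preimages under
    [phi] are twice as long. *)
Let mu_phi (A : set R) : measurable A ->
  mu A = mscale (2^-1)%:nng push A.
Proof.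
move=> mA; apply: lebesgue_measure_unique => //= _ [[a b]] _ <-.
rewrite /mscale /= /pushforward phi_preimage !lebesgue_measure_itv /= !lte_fin.
rewrite ltrBlDr subrK (ltr_pM2l (@ltr0Sn R 1)); case: ifP => _; last by rewrite mule0.
rewrite -EFinM; congr (_%:E); by field.
Qed.

Local Notation D := `[s / 2, (1 + s) / 2]%classic.

Let phi_D : phi @^-1` D = `[0, 1]%classic.
Proof.
rewrite phi_preimage; have -> : 2 * (s / 2) - s = 0 by field.
by have -> : 2 * ((1 + s) / 2) - s = 1 by field.
Qed.

Lemma ge0_integral_half (f : R -> \bar R) :
  measurable_fun [set: R] f -> (forall x, 0 <= f x)%E ->
  (\int[mu]_(x in `[0%R, 1%R]) f ((x + s) / 2)%R = 2%:E * \int[mu]_(x in D) f x)%E.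
Proof.
move=> mf f0.
rewrite [in RHS](eq_measure_integral (mscale (2^-1)%:nng push)); last first.
  by move=> A mA _; exact: mu_phi.
rewrite [in RHS]ge0_integral_mscale //=; last exact: measurable_funTS.
rewrite ge0_integral_pushforward //=; last exact: measurable_funTS.
by rewrite phi_D muleA -EFinM mulfV ?mul1e.
Qed.

Lemma integrable_half (g : R -> R) : measurable_fun [set: R] g ->
  mu.-integrable D (EFin \o g) ->
  mu.-integrable `[0, 1] (EFin \o (fun t => g ((t + s) / 2))).
Proof.
move=> mg /integrableP [_ gfin]; apply/integrableP; split.
  apply/measurable_EFinP; apply: measurable_funTS.
  exact: (measurableT_comp mg mphi).
have mE : measurable_fun [set: R] (fun x => `|(g x)%:E|%E).
  by apply: measurableT_comp => //; exact/measurable_EFinP.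
have := ge0_integral_half mE (fun x => abse_ge0 _).
by rewrite /= => ->; apply: lte_mul_pinfty.
Qed.

Lemma Rintegral_half (g : R -> R) : measurable_fun [set: R] g ->
  mu.-integrable D (EFin \o g) ->
  \int[mu]_(t in `[0, 1]) g ((t + s) / 2) = 2 * \int[mu]_(t in D) g t.
Proof.
move=> mg ig; rewrite /Rintegral.
have mE : measurable_fun [set: R] (EFin \o g) by exact/measurable_EFinP.
rewrite integralE [X in _ = 2 * fine X]integralE.
have hp := ge0_integral_half (measurable_funepos mE) (funepos_ge0 _).
have hn := ge0_integral_half (measurable_funeneg mE) (funeneg_ge0 _).
have fp : (\int[mu]_(x in D) (EFin \o g)^\+ x)%E \is a fin_num.
  exact: integrable_pos_fin_num.
have fn : (\int[mu]_(x in D) (EFin \o g)^\- x)%E \is a fin_num.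
  exact: integrable_neg_fin_num.
transitivity (fine (\int[mu]_(x in `[0%R, 1%R]) (EFin \o g)^\+ ((x + s) / 2)%R
  - \int[mu]_(x in `[0%R, 1%R]) (EFin \o g)^\- ((x + s) / 2)%R)%E).
  have h0 := fun (f : R -> \bar R) => (funepos_comp f phi, funeneg_comp f phi).
  congr (fine (_ - _))%E; apply: eq_integral => x _.
    exact: (congr1 (@^~ x) (h0 (EFin \o g)).1).
  exact: (congr1 (@^~ x) (h0 (EFin \o g)).2).
rewrite hp hn -(fineK fp) -(fineK fn) -!EFinM -!EFinB /=; ring.
Qed.

End HalfScaling.

(** * An integrable majorant for logarithmic singularities *)

Section LogBound.
Context {R : realType}.
Local Notation mu := (@lebesgue_measure R).

Definition dyadic_itv (b : R) (j : nat) : set R := `[b - 2^-1 ^+ j, b + 2^-1 ^+ j].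

(* Dominates - ln |t - b| and has the value +oo at b. *)
Definition log_majorant (b t : R) : \bar R :=
  (\sum_(0 <= j <oo) (ln 2 * \1_(dyadic_itv b j) t)%:E)%E.

Let ln2_gt0 : 0 < ln (2 : R). Proof. by rewrite ln_gt0 // ltr1n. Qed.

Let term_ge0 b t j : (0 <= (ln 2 * \1_(dyadic_itv b j) t : R)%:E)%E.
Proof. by rewrite lee_fin mulr_ge0 // ltW. Qed.

Let mterm b j : measurable_fun [set: R] (fun t => (ln 2 * \1_(dyadic_itv b j) t : R)%:E).
Proof.
apply/measurable_EFinP; apply: measurable_funM => //.
by apply: measurable_indic; exact: measurable_itv.
Qed.

Lemma log_majorant_ge0 b t : (0 <= log_majorant b t)%E.
Proof. by apply: nneseries_ge0 => j _ _; exact: term_ge0. Qed.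

Lemma measurable_log_majorant b : measurable_fun [set: R] (log_majorant b).
Proof.
by apply: ge0_emeasurable_sum => // j *; exact: mterm.
Qed.

(** For [v >= 0] the point [t] lies in the intervals of index [j <= v / ln 2], and the corresponding
    terms [ln 2] add up to at least [v]. The hypothesis with [expR] also covers [t = b], where it
    holds for every [v]. *)
Lemma log_majorant_ge b t v : `|t - b| <= expR (- v) -> (v%:E <= log_majorant b t)%E.
Proof.
move=> h; have [v0|v0] := ltrP v 0.
  by apply: le_trans (log_majorant_ge0 b t); rewrite lee_fin ltW.
pose N := Num.truncn (v / ln 2).
have /andP [N1 N2] : N%:R <= v / ln 2 < N.+1%:R.
  by apply: Num.Theory.truncn_itv; rewrite divr_ge0 // ltW.
have hj j : (j < N.+1)%N -> \1_(dyadic_itv b j) t = 1 :> R.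
  rewrite ltnS -(ler_nat R) => jN; rewrite indicE mem_set //.
  suff hle : `|t - b| <= 2^-1 ^+ j.
    by rewrite /dyadic_itv /= in_itv /=; move: hle; rewrite ler_norml; lra.
  apply: le_trans h _; rewrite -[leRHS]lnK; last by rewrite posrE exprn_gt0.
  rewrite ler_expR lnXn // lnV ?posrE // mulNrn lerN2 -[ln 2 *+ j]mulr_natl.
  by rewrite -ler_pdivlMr // (le_trans jN).
apply: le_trans (nneseries_lim_ge N.+1 (fun j _ _ => term_ge0 b t j)).
rewrite sumEFin lee_fin big_nat (eq_bigr (fun=> ln 2)); last first.
  by move=> j /andP[_ jN]; rewrite hj ?mulr1.
rewrite -big_nat big_const_nat subn0 iter_addr_0 -[ln 2 *+ _]mulr_natl.
by rewrite -ler_pdivrMr // ltW.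
Qed.

Lemma integral_log_majorant b : (\int[mu]_(t in `[0%R, 1%R]) log_majorant b t <= (4 * ln 2)%:E)%E.
Proof.
rewrite integral_nneseries //; [|by move=> j; apply: measurable_funTS; exact: mterm].
(* The [j]-th interval has length [2 / 2^j], so the [j]-th integral is at most
   [4 ln 2 / 2^(j+1)]. *)
apply: le_trans (epsilon_trick0 xpredT _); last by rewrite mulr_ge0 // ltW.
apply: lee_nneseries => [j _ _|j _].
  by apply: integral_ge0 => t _; exact: term_ge0.
under eq_integral do rewrite EFinM.
rewrite ge0_integralZl_EFin //; last 2 first.
- by apply/measurable_EFinP; apply: measurable_funTS; apply: measurable_indic; exact: measurable_itv.
- exact: ltW.
rewrite integral_indic //; last exact: measurable_itv.
have : (mu (dyadic_itv b j `&` `[0%R, 1%R]) <= mu (dyadic_itv b j))%E.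
  have mI : measurable (dyadic_itv b j) by exact: measurable_itv.
  apply: le_measure; rewrite ?inE //; first by apply: measurableI => //; exact: measurable_itv.
rewrite {2}/dyadic_itv lebesgue_measure_itv /= lte_fin.
have hj : 0 < 2^-1 ^+ j :> R by rewrite exprn_gt0.
have -> : b - 2^-1 ^+ j < b + 2^-1 ^+ j by lra.
rewrite -EFinD => h; apply: (le_trans (lee_wpmul2l _ h)); first by rewrite lee_fin ltW.
rewrite -EFinM lee_fin natrX exprS exprVn.
have : (2 ^+ j : R) != 0 by rewrite expf_neq0.
by move: (2 ^+ j) (ln 2) => x l x0; rewrite le_eqVlt; apply/orP; left; apply/eqP; field.
Qed.

End LogBound.

(** * Distances on the unit circle *)

Section Circle.
Context {R : realType}.

Definition modulus (z : R[i]) : R := complex.Re `|z|.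

Lemma modulusE (x y : R) : modulus (x +i* y) = Num.sqrt (x ^+ 2 + y ^+ 2).
Proof. by []. Qed.

Lemma modulus_ge0 z : 0 <= modulus z.
Proof. by case: z => x y; rewrite modulusE sqrtr_ge0. Qed.

Lemma norm_modulus (z : R[i]) : `|z| = (modulus z)%:C.
Proof. by rewrite /modulus normc_def. Qed.

Lemma modulusM z w : modulus (z * w) = modulus z * modulus w.
Proof. by apply: complexI; rewrite rmorphM -!norm_modulus normrM. Qed.

Lemma modulusN z : modulus (- z) = modulus z.
Proof. by rewrite /modulus normrN. Qed.

Lemma modulusD z w : modulus (z + w) <= modulus z + modulus w.
Proof. by rewrite -lecR rmorphD /= -!norm_modulus ler_normD. Qed.

Lemma modulus_eq0 z : (modulus z == 0) = (z == 0).
Proof. by rewrite -[RHS]normr_eq0 norm_modulus -(inj_eq (@complexI R)). Qed.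

Lemma modulus_gt0 z : (0 < modulus z) = (z != 0).
Proof. by rewrite lt_def modulus_ge0 modulus_eq0 andbT. Qed.

Lemma modulus_unit_circle (t : R) : modulus (unit_circle t) = 1.
Proof. by rewrite /unit_circle modulusE cos2Dsin2 sqrtr1. Qed.

(** For [z = y / 2] the mean value theorem gives [sin z >= z cos z], hence [sin y >= 2 z (cos z)^2 =
    z (1 + cos y) >= z]. *)
Lemma half_le_sin (y : R) : 0 <= y <= pi / 2 -> y / 2 <= sin y.
Proof.
move=> /andP[y0 ypi]; have pi0 := @pi_gt0 R.
have [->|yn0] := eqVneq y 0; first by rewrite sin0 mul0r.
have {}y0 : 0 < y by rewrite lt_neqAle eq_sym yn0.
have [z yz] : exists z, y = z + z by exists (y / 2); lra.
have z0 : 0 < z by lra.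
have [c] := @MVT R sin cos 0 z z0 (fun x _ => is_derive_sin x)
   (continuous_subspaceT (@continuous_sin R)).
rewrite in_itv /= sin0 !subr0 => /andP[c0 cz] sz.
have cosz : cos z <= cos c.
  have hc : c \in `[0, pi] by rewrite in_itv /=; lra.
  have hz : z \in `[0, pi] by rewrite in_itv /=; lra.
  by rewrite ltW // ltr_cos.
have cosy : 0 <= cos y by apply: cos_ge0_pihalf; lra.
have cz2 : cos y = cos z ^+ 2 *+ 2 - 1 by rewrite yz -mulr2n cos_mulr2n.
have cz0 : 0 <= cos z by apply: cos_ge0_pihalf; lra.
have -> : sin y = 2 * sin z * cos z by rewrite yz sinD; ring.
have hzz : 1 <= 2 * cos z ^+ 2 by lra.
have : cos z * cos z <= cos c * cos z by rewrite ler_wpM2r.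
by rewrite sz; nra.
Qed.

Lemma sin_pi_ge (u : R) : 0 <= u <= 1 -> u * (1 - u) * (1 + u) <= 2 * sin (pi * u).
Proof.
move=> /andP[u0 u1]; have pi2 := @pi_ge2 R.
have [uh|uh] := lerP u (1 / 2).
  have h : pi * u / 2 <= sin (pi * u).
    by apply: half_le_sin; nra.
  nra.
have h : pi * (1 - u) / 2 <= sin (pi * (1 - u)).
  by apply: half_le_sin; nra.
have -> : sin (pi * u) = sin (pi * (1 - u)).
  have -> : pi * (1 - u) = pi - pi * u by ring.
  by rewrite sinB sinpi cospi mul0r sub0r mulN1r opprK.
have h2 : pi * (1 - u) >= 2 * (1 - u) by rewrite ler_wpM2r; lra.
have h3 : 0 <= (1 - u) * (1 - u) * (2 + u) by rewrite !mulr_ge0; lra.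
move: h h2; move: (pi * _) (sin _) => x y h h2; nra.
Qed.

(** The chord is [2 sin (pi |t - a|)], bounded below by [sin_pi_ge]. The factors at [a - 1] and
    [a + 1] account for the wrapping of the unit interval around the circle. *)
Lemma modulus_unit_circleB (t a : R) : 0 <= t <= 1 -> 0 <= a <= 1 ->
  `|t - (a - 1)| * `|t - a| * `|t - (a + 1)| <= modulus (unit_circle t - unit_circle a).
Proof.
wlog lat : t a / a <= t.
  move=> H ht ha; case/orP: (le_total a t) => lta; first exact: H.
  rewrite -[unit_circle t - _]opprB modulusN; apply: le_trans (H a t lta ha ht).
  rewrite [`|t - (a - 1)|]distrC [`|t - a|]distrC [`|t - (a + 1)|]distrC.
  have -> : a - 1 - t = a - (t + 1) by ring.
  have -> : a + 1 - t = a - (t - 1) by ring.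
  by rewrite mulrC mulrA mulrAC.
move=> ht ha; rewrite /unit_circle.
have -> : cos (2 * pi * t) +i* sin (2 * pi * t) - cos (2 * pi * a) +i* sin (2 * pi * a) =
  (cos (2 * pi * t) - cos (2 * pi * a)) +i* (sin (2 * pi * t) - sin (2 * pi * a)) by [].
pose u := t - a; have hu : 0 <= u <= 1 by rewrite /u; lra.
rewrite modulusE.
have -> : (cos (2 * pi * t) - cos (2 * pi * a)) ^+ 2 + (sin (2 * pi * t) - sin (2 * pi * a)) ^+ 2
   = (2 * sin (pi * u)) ^+ 2.
  have e x y : (cos x - cos y) ^+ 2 + (sin x - sin y) ^+ 2 = 2 - 2 * cos (x - y) :> R.
    by rewrite cosB; have := cos2Dsin2 x; have := cos2Dsin2 y; nra.
  rewrite e; have -> : 2 * pi * t - 2 * pi * a = (pi * u) *+ 2 by rewrite /u; ring.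
  by rewrite cos_mulr2n; have := cos2Dsin2 (pi * u); nra.
have h := sin_pi_ge hu.
rewrite sqrtr_sqr [`|2 * _|]ger0_norm; last by apply: le_trans h; rewrite !mulr_ge0; lra.
apply: le_trans h; rewrite /u [`|t - (a - 1)|]ger0_norm ?[`|t - a|]ger0_norm; try lra.
rewrite [`|t - (a + 1)|]ler0_norm; last by lra.
by rewrite le_eqVlt; apply/orP; left; apply/eqP; ring.
Qed.

End Circle.

(** * Integrability of the logarithmic distance *)

Section LogDistance.
Context {R : realType}.
Local Notation mu := (@lebesgue_measure R).
Local Notation I01 := (`[(0 : R), (1 : R)]%classic).

Definition log_dist (z : R[i]) (t : R) : R := ln (modulus (unit_circle t - z)).

Lemma continuous_dist (z : R[i]) : continuous (fun t => modulus (unit_circle t - z)).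
Proof.
case: z => x y t.
have h : continuous (fun t : R => 2 * pi * t).
  by move=> u; apply: cvgM; [exact: cvg_cst|exact: cvg_id].
have -> : (fun t => modulus (unit_circle t - (x +i* y))) = 
    (fun t => Num.sqrt ((cos (2 * pi * t) - x) ^+ 2 + (sin (2 * pi * t) - y) ^+ 2)) by [].
apply: (@continuous_comp _ _ _ (fun t => (cos (2 * pi * t) - x) ^+ 2 + (sin (2 * pi * t) - y) ^+ 2)); last exact: sqrt_continuous.
have hc : continuous (fun t : R => cos (2 * pi * t) - x).
  move=> u; apply: cvgB; last exact: cvg_cst.
  by apply: (@continuous_comp _ _ _ (fun t => 2 * pi * t) cos); [exact: h|exact: continuous_cos].
have hs : continuous (fun t : R => sin (2 * pi * t) - y).
  move=> u; apply: cvgB; last exact: cvg_cst.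
  by apply: (@continuous_comp _ _ _ (fun t => 2 * pi * t) sin); [exact: h|exact: continuous_sin].
exact: (cvgD (cvgM (hc t) (hc t)) (cvgM (hs t) (hs t))).
Qed.

Lemma measurable_log_dist (z : R[i]) : measurable_fun [set: R] (log_dist z).
Proof.
apply: (measurableT_comp (@measurable_ln R)).
by apply: continuous_measurable_fun; exact: continuous_dist.
Qed.

(** Let [a] give a point of the circle nearest to [z]. By the triangle inequality the distance from
    [unit_circle t] to this point is at most twice its distance to [z]. *)
Lemma nearest_point (z : R[i]) : exists2 a : R, 0 <= a <= 1 &
  forall t, 0 <= t <= 1 ->
  `|t - (a - 1)| * `|t - a| * `|t - (a + 1)| <= 2 * modulus (unit_circle t - z).
Proof.
have [a ha hmin] := EVT_min ler01 (continuous_subspaceT (@continuous_dist z)).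
rewrite in_itv /= in ha; exists a => // t ht.
apply: le_trans (modulus_unit_circleB ht ha) _.
have -> : unit_circle t - unit_circle a = (unit_circle t - z) + - (unit_circle a - z) by ring.
apply: le_trans (modulusD _ _) _; rewrite modulusN.
have := hmin t; rewrite in_itv /= => /(_ ht); lra.
Qed.

Lemma unit_circle_fiber_negligible (z : R[i]) :
  mu.-negligible [set t | I01 t /\ unit_circle t = z].
Proof.
have [a _ hm] := nearest_point z.
have neg1 (b : R) : mu.-negligible [set b].
  by exists [set b]; split => //; exact: lebesgue_measure_set1.
have neg3 : mu.-negligible ([set a - 1] `|` [set a] `|` [set a + 1]).
  by apply: negligibleU => //; apply: negligibleU.
apply: negligibleS neg3 => t [] /=; rewrite in_itv /= => ht tz.
have := hm t ht; rewrite tz subrr /modulus normr0 /= mulr0 => h.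
have : `|t - (a - 1)| * `|t - a| * `|t - (a + 1)| == 0.
  by rewrite eq_le h !mulr_ge0.
rewrite !mulf_eq0 !normr_eq0 !subr_eq0 => /orP[/orP[]|] /eqP ->.
- by left; left.
- by left; right.
- by right.
Qed.

Lemma log_dist_majorant (z : R[i]) : modulus z <= 1 -> exists a : R,
  forall t, 0 <= t <= 1 -> (`|log_dist z t|%:E <=
    (ln 2)%:E + (log_majorant (a - 1) t + log_majorant a t + log_majorant (a + 1) t))%E.
Proof.
move=> hz; have [a ha hm] := nearest_point z; exists a => t ht.
have ln2 : 0 <= ln (2 : R) by rewrite ln_ge0 // ler1n.
have h0 b : (0 <= log_majorant b t)%E := log_majorant_ge0 b t.
have := hm t ht.
set m := modulus _; rewrite /log_dist -/m.
(* At distance 0 the convention [ln 0 = 0] makes the bound trivial. *)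
have [m0|m0] := leP m 0.
  have -> : m = 0 by apply/eqP; rewrite eq_le m0 modulus_ge0.
  by move=> _; rewrite ln0 // normr0 !adde_ge0 // lee_fin.
have mle2 : m <= 2.
  apply: le_trans (modulusD _ _) _; rewrite modulus_unit_circle modulusN; lra.
have lnm : ln m <= ln 2 by rewrite ler_ln ?posrE //.
(* Where a factor of the cubic vanishes, [hprod] says nothing, but the majorant at that point
   exceeds every real number. *)
have zero b : `|t - b| = 0 -> (`|ln m|%:E <= log_majorant b t)%E.
  by move=> tb; apply: log_majorant_ge; rewrite tb expR_ge0.
have sumle (A B C D : \bar R) : (0 <= A -> 0 <= B -> 0 <= C -> 0 <= D ->
    [/\ B <= A + (B + C + D), C <= A + (B + C + D) & D <= A + (B + C + D)])%E.
  move=> A0 B0 C0 D0; have hA := leeDr (B + C + D) A0.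
  split; apply: le_trans hA.
  - exact: le_trans (leeDl _ C0) (leeDl _ D0).
  - exact: le_trans (leeDr _ B0) (leeDl _ D0).
  - by rewrite leeDr // adde_ge0.
have [s1 s2 s3] := sumle (ln 2)%:E _ _ _ ln2 (h0 (a - 1)) (h0 a) (h0 (a + 1)).
move: (zero (a - 1)) (zero a) (zero (a + 1)) => z1 z2 z3 hprod.
have lnb b : 0 < `|t - b| -> ((- ln `|t - b|)%:E <= log_majorant b t)%E.
  by move=> tb; apply: log_majorant_ge; rewrite opprK lnK.
have [/z1/le_trans|e1] := eqVneq `|t - (a - 1)| 0; first exact.
have [/z2/le_trans|e2] := eqVneq `|t - a| 0; first exact.
have [/z3/le_trans|e3] := eqVneq `|t - (a + 1)| 0; first exact.
rewrite normr_eq0 -normr_gt0 in e1; rewrite normr_eq0 -normr_gt0 in e2.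
rewrite normr_eq0 -normr_gt0 in e3.
have [lm0|lm0] := leP 0 (ln m).
  rewrite ger0_norm //; apply: (@le_trans _ _ (ln 2)%:E); first by rewrite lee_fin.
  by rewrite leeDl // !adde_ge0.
rewrite ltr0_norm //.
apply: (@le_trans _ _ ((ln 2)%:E + ((- ln `|t - (a - 1)|)%:E + (- ln `|t - a|)%:E + (- ln `|t - (a + 1)|)%:E))%E); last first.
  by rewrite leeD2l // !leeD // lnb.
rewrite -!EFinD lee_fin.
have : ln (`|t - (a - 1)| * `|t - a| * `|t - (a + 1)|) <= ln (2 * m).
  by rewrite ler_ln ?posrE ?mulr_gt0.
rewrite !lnM ?posrE ?mulr_gt0 //; lra.
Qed.

Definition log_bound : R := ln 2 + (4 * ln 2 + 4 * ln 2 + 4 * ln 2).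

(** The bound is uniform in [z], as [log_mean_le1] applies it to all iterated squares of a point. *)
Lemma integral_log_dist_bound (z : R[i]) : modulus z <= 1 ->
  (\int[mu]_(t in I01) `|(log_dist z t)%:E| <= log_bound%:E)%E.
Proof.
move=> /log_dist_majorant [a ha].
have mI : measurable (I01 : set (measurableTypeR R)) by exact: measurable_itv.
have mh b : measurable_fun I01 (@log_majorant R b).
  by apply: measurable_funTS; exact: measurable_log_majorant.
have h0 b t : (0 <= log_majorant b t :> \bar R)%E := log_majorant_ge0 b t.
have ln2 : 0 <= ln (2 : R) by rewrite ln_ge0 // ler1n.
have mh2 := emeasurable_funD (mh (a - 1)) (mh a).
have mh3 := emeasurable_funD mh2 (mh (a + 1)).
apply: (@le_trans _ _ (\int[mu]_(t in I01) ((ln 2)%:E + (log_majorant (a - 1) t + log_majorant a t + log_majorant (a + 1) t)))%E).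
  apply: ge0_le_integral => //.
  - apply: measurableT_comp => //; apply/measurable_EFinP; apply: measurable_funTS.
    exact: measurable_log_dist.
  - exact: emeasurable_funD.
rewrite ge0_integralD //=; last by move=> t _; rewrite !adde_ge0.
have muI : mu I01 = 1%E.
  by rewrite lebesgue_measure_itv /= lte_fin ltr01 -EFinD subr0.
rewrite integral_cst // [X in (_ * X + _)%E](_ : _ = 1%E) ?mule1; last exact: muI.
rewrite /log_bound EFinD leeD2l //.
rewrite ge0_integralD //=; [|by move=> *; rewrite adde_ge0|exact: mh].
rewrite ge0_integralD //=; [|exact: mh|exact: mh].
rewrite !EFinD.
by rewrite !leeD // integral_log_majorant.
Qed.

Lemma integrable_log_dist (z : R[i]) : modulus z <= 1 ->
  mu.-integrable I01 (EFin \o log_dist z).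
Proof.
move=> hz; apply/integrableP; split.
  by apply/measurable_EFinP; apply: measurable_funTS; exact: measurable_log_dist.
by apply: le_lt_trans (integral_log_dist_bound hz) _; rewrite ltry.
Qed.

End LogDistance.

(** * The mean of the logarithmic distance over the circle *)

Section Jensen.
Context {R : realType}.
Local Notation mu := (@lebesgue_measure R).
Local Notation I01 := (`[(0 : R), (1 : R)]%classic).

Lemma unit_circle_fibers_negligible (s : seq R[i]) :
  mu.-negligible [set t | I01 t /\ unit_circle t \in s].
Proof.
elim: s => [|z s IHs].
  by apply: negligibleS (negligible_set0 mu) => t [].
apply: negligibleS (negligibleU (unit_circle_fiber_negligible z) IHs) => t [ht].
by rewrite in_cons => /orP[/eqP tz|ts]; [left|right].
Qed.

Lemma eq_Rintegral_off_fibers (s : seq R[i]) (f g : R -> R) :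
  measurable_fun [set: R] f -> measurable_fun [set: R] g ->
  (forall t, 0 <= t <= 1 -> unit_circle t \notin s -> f t = g t) ->
  \int[mu]_(t in I01) f t = \int[mu]_(t in I01) g t.
Proof.
move=> mf mg fg; congr fine; apply: ae_eq_integral.
- exact: measurable_itv.
- by apply/measurable_EFinP; exact: measurable_funTS.
- by apply/measurable_EFinP; exact: measurable_funTS.
apply: negligibleS (unit_circle_fibers_negligible s) => t /= h.
have [It|nIt] := pselect (I01 t); last by case: h => /nIt.
split => //; apply/negPn/negP => hs; apply: h => _.
by rewrite fg //; move: It; rewrite /= in_itv.
Qed.

Definition log_mean (z : R[i]) : R := \int[mu]_(t in I01) log_dist z t.

Lemma unit_circle_half (t : R) : unit_circle (t / 2) ^+ 2 = unit_circle t.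
Proof.
rewrite /unit_circle expr2; apply/eqP; rewrite eq_complex /=.
have -> : 2 * pi * t = 2 * pi * (t / 2) + 2 * pi * (t / 2) :> R by field.
by rewrite cosD sinD; apply/andP; split; apply/eqP; ring.
Qed.

Lemma unit_circle_half1 (t : R) : unit_circle ((t + 1) / 2) = - unit_circle (t / 2).
Proof.
rewrite /unit_circle.
have -> : 2 * pi * ((t + 1) / 2) = 2 * pi * (t / 2) + pi :> R by field.
by rewrite sinDpi cosDpi.
Qed.

(** The parameters [t / 2] and [(t + 1) / 2] give the two square roots [u], [-u] of [unit_circle t],
    and [(u - z) (- u - z) = - (u^2 - z^2)]. The hypothesis excludes [ln 0], where [ln] is not
    additive. *)
Lemma log_dist_half (z : R[i]) (t : R) : unit_circle t != z ^+ 2 ->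
  log_dist z (t / 2) + log_dist z ((t + 1) / 2) = log_dist (z ^+ 2) t.
Proof.
move=> tz; rewrite /log_dist unit_circle_half1.
have e : (unit_circle (t / 2) - z) * (- unit_circle (t / 2) - z) = - (unit_circle t - z ^+ 2).
  by rewrite -[unit_circle t]unit_circle_half; ring.
have nz : (unit_circle (t / 2) - z) * (- unit_circle (t / 2) - z) != 0.
  by rewrite e oppr_eq0 subr_eq0.
move: nz; rewrite mulf_eq0 negb_or => /andP[n1 n2].
by rewrite -lnM ?posrE ?modulus_gt0 // -modulusM e modulusN.
Qed.

Lemma log_mean_sqr (z : R[i]) : modulus z <= 1 -> log_mean (z ^+ 2) = 2 * log_mean z.
Proof.
move=> hz; have iz := integrable_log_dist hz; have mz := measurable_log_dist z.
have sub (a b : R) : 0 <= a -> b <= 1 -> mu.-integrable `[a, b] (EFin \o log_dist z).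
  move=> a0 b1; apply: integrableS iz; try exact: measurable_itv.
  by move=> t; rewrite /= !in_itv /=; lra.
have h0 : mu.-integrable `[0 / 2, (1 + 0) / 2] (EFin \o log_dist z) by apply: sub; lra.
have h1 : mu.-integrable `[1 / 2, (1 + 1) / 2] (EFin \o log_dist z) by apply: sub; lra.
have e0 := Rintegral_half mz h0; have e1 := Rintegral_half mz h1.
have i0 := integrable_half mz h0; have i1 := integrable_half mz h1.
have -> : log_mean z = \int[mu]_(t in `[0 / 2, (1 + 0) / 2]) log_dist z t +
    \int[mu]_(t in `[1 / 2, (1 + 1) / 2]) log_dist z t.
  have -> : (1 + 1) / 2 = 1 :> R by field.
  rewrite mul0r addr0 -(Rintegral_itv_obnd_cbnd (r := 1 / 2)); last first.
    apply: integrableS iz; try exact: measurable_itv.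
    by move=> t; rewrite /= !in_itv /=; lra.
  have := @Rintegral_itvB R (log_dist z) (BLeft 0) (BRight 1) (1 / 2) iz.
  rewrite !bnd_simp => <-; try lra.
  by rewrite addrC subrK.
rewrite mulrDr -e0 -e1 -RintegralD //.
apply: (@eq_Rintegral_off_fibers [:: z ^+ 2]).
- exact: measurable_log_dist.
- have mhalf (s : R) : measurable_fun [set: R] (fun t => log_dist z ((t + s) / 2)).
    apply: (measurableT_comp mz); apply: measurable_funM => //.
    by apply: measurable_funD.
  exact: measurable_funD.
move=> t ht; rewrite inE => tz; rewrite addr0.
by rewrite log_dist_half.
Qed.

(* log_mean (z^2) = 2 log_mean z, while log_mean is bounded on the unit disc. *)
Lemma log_mean_le1 (z : R[i]) : modulus z <= 1 -> log_mean z = 0.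
Proof.
move=> hz.
have pow j : modulus (z ^+ (2 ^ j)) <= 1 /\ log_mean (z ^+ (2 ^ j)) = 2 ^+ j * log_mean z.
  elim: j => [|j [IH1 IH2]]; first by rewrite expn0 !expr1 expr0 mul1r.
  rewrite expnS mulnC exprM; split; last by rewrite log_mean_sqr // IH2 exprS mulrA.
  rewrite expr2 modulusM; have := modulus_ge0 (z ^+ (2 ^ j)); nra.
have bound w : modulus w <= 1 -> `|log_mean w| <= log_bound.
  move=> hw; have iw := integrable_log_dist hw.
  rewrite /log_mean -lee_fin EFin_normr_Rintegral //.
  apply: le_trans (integral_log_dist_bound hw).
  apply: le_abse_integral; first exact: measurable_itv.
  by apply/measurable_EFinP; apply: measurable_funTS; exact: measurable_log_dist.
apply/eqP/negPn/negP => L0; have {}L0 : 0 < `|log_mean z| by rewrite normr_gt0.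
pose N := (Num.truncn (log_bound / `|log_mean z|)).+1.
have h1 : log_bound / `|log_mean z| < N%:R :> R by exact: Num.Theory.truncnS_gt.
have [hp1 hp2] := pow N; have := bound _ hp1; rewrite hp2 normrM normrX ger0_norm //.
rewrite -ler_pdivlMr // => h2.
have : (N%:R : R) <= 2 ^+ N by rewrite -natrX ler_nat ltnW // ltn_expl.
by move/(lt_le_trans h1)/lt_le_trans/(_ h2); rewrite ltxx.
Qed.

(* For [|u| = 1], [|u - z| = |z| |u - 1 / z^*|]: reflection in the unit circle. *)
Lemma log_dist_gt1 (z : R[i]) : 1 < modulus z ->
  exists2 w, modulus w <= 1 & log_dist z = (fun t => ln (modulus z) + log_dist w t).
Proof.
move=> hz; have m0 : 0 < modulus z by apply: lt_trans hz.
pose w := (z^*)^-1.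
have z0 : z^* != 0 by rewrite conjc_eq0 -modulus_gt0.
have modJ (u : R[i]) : modulus u^* = modulus u by rewrite /modulus normcJ.
have mw : modulus w = (modulus z)^-1.
  apply: (mulIf (lt0r_neq0 m0)); rewrite [RHS]mulVf ?gt_eqF // -(modJ z) -modulusM.
  by rewrite mulVf // /modulus normr1.
have dist t : modulus (unit_circle t - z) = modulus z * modulus (unit_circle t - w).
  set u := unit_circle t.
  have uu : u * u^* = 1.
    by rewrite -sqr_normc norm_modulus modulus_unit_circle expr1n.
  rewrite -(modJ z) -modulusM mulrBr /w mulfV // -uu [u * _]mulrC -mulrBl modulusM.
  by rewrite modulus_unit_circle mulr1 -rmorphB modJ -modulusN opprB.
exists w; first by rewrite mw invf_le1 ?ltW.
apply/funext => t; rewrite /log_dist dist lnM ?posrE // modulus_gt0.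
apply: contraTneq hz => /eqP; rewrite subr_eq0 => /eqP tw.
have := mw; rewrite -tw modulus_unit_circle => /(congr1 GRing.inv).
by rewrite invrK invr1 => <-; rewrite ltxx.
Qed.

Let mI : measurable (I01 : set (measurableTypeR R)).
Proof. exact: measurable_itv. Qed.

Let muI : mu I01 = 1%E.
Proof. by rewrite lebesgue_measure_itv /= lte_fin ltr01 -EFinD subr0. Qed.

Let integrable_cst01 (c : R) : mu.-integrable I01 (EFin \o (fun=> c)).
Proof.
apply/integrableP; split; first by apply/measurable_EFinP.
by rewrite integral_cst //= [X in (_ * X)%E](_ : _ = 1%E) ?mule1 ?ltry //; exact: muI.
Qed.

Lemma integrable_log_dist01 (z : R[i]) : mu.-integrable I01 (EFin \o log_dist z).
Proof.
have [h|h] := leP (modulus z) 1; first exact: integrable_log_dist.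
have [w hw ->] := log_dist_gt1 h.
apply: (@eq_integrable _ _ _ mu I01 mI
  ((EFin \o (fun=> ln (modulus z))) \+ (EFin \o log_dist w))%E) => //.
by apply: integrableD => //; exact: integrable_log_dist.
Qed.

Lemma log_mean_gt1 (z : R[i]) : 1 < modulus z -> log_mean z = ln (modulus z).
Proof.
move=> hz; rewrite /log_mean; have [w hw ->] := log_dist_gt1 hz.
rewrite RintegralD //; last exact: integrable_log_dist.
by rewrite -/(log_mean w) log_mean_le1 // addr0 Rintegral_cst // [X in fine X]muI /= mulr1.
Qed.

Lemma log_mean_ge0 (z : R[i]) : 0 <= log_mean z.
Proof.
have [h|h] := leP (modulus z) 1; first by rewrite log_mean_le1.
by rewrite log_mean_gt1 // ln_ge0 // ltW.
Qed.

Lemma log_mean_eq0 (z : R[i]) : (log_mean z == 0) = (modulus z <= 1).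
Proof.
have [h|h] := leP (modulus z) 1; first by rewrite log_mean_le1 ?eqxx.
by rewrite log_mean_gt1 // gt_eqF // ln_gt0.
Qed.

Lemma Rintegral_log_prod (rs : seq R[i]) :
  \int[mu]_(t in I01) ln (modulus (\prod_(x <- rs) ('X - x%:P)).[unit_circle t]) =
  \sum_(x <- rs) log_mean x.
Proof.
have modE t : modulus (\prod_(x <- rs) ('X - x%:P)).[unit_circle t] =
    \prod_(x <- rs) modulus (unit_circle t - x).
  rewrite horner_prod; elim: rs => [|x rs IHs].
    by rewrite !big_nil /modulus normr1.
  by rewrite !big_cons modulusM IHs !hornerE.
have mprod (s : seq R[i]) : measurable_fun [set: R] (fun t => \prod_(x <- s) modulus (unit_circle t - x)).
  elim: s => [|x s IHs].
    by under eq_fun do rewrite big_nil; exact: measurable_cst.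
  under eq_fun do rewrite big_cons; apply: measurable_funM => //.
  by apply: continuous_measurable_fun; exact: continuous_dist.
have msum (s : seq R[i]) : measurable_fun [set: R] (fun t => \sum_(x <- s) log_dist x t).
  elim: s => [|x s IHs].
    by under eq_fun do rewrite big_nil; exact: measurable_cst.
  under eq_fun do rewrite big_cons; apply: measurable_funD => //.
  exact: measurable_log_dist.
under eq_Rintegral do rewrite modE.
rewrite (@eq_Rintegral_off_fibers rs _ (fun t => \sum_(x <- rs) log_dist x t)) //; last 2 first.
- exact: (measurableT_comp (@measurable_ln R) (mprod rs)).
- move=> t _; elim: rs {modE} => [|x rs IHs]; first by rewrite !big_nil ln1.
  rewrite in_cons negb_or => /andP[tx ts]; rewrite !big_cons lnM ?IHs // posrE.
    by rewrite modulus_gt0 subr_eq0.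
  rewrite big_seq; apply: prodr_gt0 => y ys; rewrite modulus_gt0 subr_eq0.
  by apply: contraNneq ts => ->.
have int_sum (s : seq R[i]) : mu.-integrable I01 (EFin \o (fun t => \sum_(x <- s) log_dist x t)).
  elim: s => [|x s IHs].
    have -> : (fun t => \sum_(x <- [::]) log_dist x t) = fun=> 0 :> R.
      by apply/funext => t; rewrite big_nil.
    exact: integrable_cst01.
  apply: (@eq_integrable _ _ _ mu I01 mI
    ((EFin \o log_dist x) \+ (EFin \o (fun t => (\sum_(x <- s) log_dist x t)%R)))%E) => //.
    by move=> t _ /=; rewrite big_cons.
  by apply: integrableD => //; exact: integrable_log_dist01.
elim: rs {modE} => [|x rs IHs].
  rewrite big_nil; under eq_Rintegral do rewrite big_nil.
  by rewrite Rintegral_cst // mul0r.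
rewrite big_cons -IHs; under eq_Rintegral do rewrite big_cons.
by rewrite RintegralD //; exact: integrable_log_dist01.
Qed.

(** The logarithm of the Mahler measure is the sum of [log_mean] over the roots; each term is
    nonnegative and vanishes exactly on the closed unit disc. *)
Lemma mahler_measure_eq1 (f : {poly R[i]}) : f \is monic ->
  mahler_measure f = 1 <-> (forall z, root f z -> `|z| <= 1).
Proof.
move=> mf; have [rs] := closed_field_poly_normal f.
rewrite (monicP mf) scale1r => ->.
rewrite /mahler_measure (Rintegral_log_prod rs).
have normE z : (`|z| <= 1) = (log_mean z == 0).
  by rewrite log_mean_eq0 norm_modulus -[1]/(1%:C) lecR.
split => [h z|h].
  rewrite root_prod_XsubC normE => zrs.
  have : \sum_(x <- rs) log_mean x == 0.
    by rewrite -(inj_eq (@expR_inj R)) h expR0.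
  rewrite psumr_eq0; last by move=> x _; exact: log_mean_ge0.
  by move/allP/(_ z zrs).
rewrite big_seq big1 ?expR0 // => x xrs.
by apply/eqP; rewrite -normE; apply: h; rewrite root_prod_XsubC.
Qed.

End Jensen.

(** * The exponent sets *)

Lemma finite_set_inj (T : choiceType) (F : finType) (A : set T) (f : T -> F) :
  {in A &, injective f} -> finite_set A.
Proof.
move=> inj_f; have [->|/set0P [x0 Ax0]] := eqVneq A set0; first exact: finite_set0.
pose g y := xget x0 [set x | A x /\ f x = y].
apply: sub_finite_set (finite_image g (@finite_finset F (f @` A))) => x Ax.
exists (f x); first by exists x.
rewrite /g; case: xgetP => [y -> [Ay fy]|/(_ x)]; last by case.
by apply: inj_f; rewrite ?inE.
Qed.

(** The appended 0 is the exponent of the constant term, so that all [k] monomials are indexed by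
    ['I_k]. *)
Definition exponent (k : nat) (n : k.-1.-tuple int) (i : 'I_k) : nat :=
  absz (nth 0 (rcons n 0) i).

Section ExponentSet.
Variables (k : nat) (n : k.-1.-tuple int).
Hypotheses (k_gt0 : (0 < k)%N) (hn : exponent_set k n).

Let size_n : size (rcons n 0) = k.
Proof. by rewrite size_rcons size_tuple prednK. Qed.

Let n_sorted : sorted >%R (rcons n 0) := hn.1.

Let n_ltr (i j : nat) : (i < j < k)%N -> nth 0 (rcons n 0) j < nth 0 (rcons n 0) i.
Proof.
move=> /andP[ij jk].
have gt_trans : transitive (>%R : rel int) by move=> x y z xy yz; exact: lt_trans yz xy.
have := @sorted_ltn_nth _ _ gt_trans 0 _ n_sorted i j.
by rewrite !inE size_n; apply => //; exact: ltn_trans jk.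
Qed.

Lemma exponentE (i : 'I_k) : (exponent n i)%:Z = nth 0 (rcons n 0) i.
Proof.
rewrite /exponent gez0_abs //.
have [ik|ik] := ltnP i k.-1.
  have lt : (i < k.-1 < k)%N by rewrite ik ltn_predL.
  by have := n_ltr lt; rewrite [X in X < _]nth_rcons size_tuple ltnn eqxx => /ltW.
have -> : i = k.-1 :> nat by apply/eqP; rewrite eqn_leq ik -ltnS prednK // ltn_ord.
by rewrite nth_rcons size_tuple ltnn eqxx.
Qed.

Lemma exponent_ltn (i j : 'I_k) : (i < j)%N -> (exponent n j < exponent n i)%N.
Proof. by move=> ij; rewrite -ltz_nat !exponentE n_ltr // ij ltn_ord. Qed.

Lemma exponent_inj : injective (exponent n).
Proof.
move=> i j e; apply: val_inj; case: (ltngtP i j) => // /exponent_ltn.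
  by rewrite e ltnn.
by rewrite e ltnn.
Qed.

Lemma exponent_gcd : (\big[gcdn/0]_i exponent n i = 1)%N.
Proof.
have -> : \big[gcdn/0%N]_i exponent n i = \big[gcdn/0%N]_(m <- rcons n 0) absz m.
  by rewrite (big_nth 0) size_n big_mkord.
rewrite big_rcons_op /= gcdn0.
have -> : \big[gcdn/0%N]_(m <- n) absz m = absz (\big[gcdz/0]_(m <- n) m).
  by rewrite (big_morph absz (id1 := 0%N) (op1 := gcdn)).
by rewrite hn.2.
Qed.

Lemma sum_polyE (R : realType) :
  sum_poly R n = map_poly intr (\sum_i 'X^(exponent n i) : {poly int}).
Proof.
rewrite rmorph_sum /=; under eq_bigr do rewrite map_polyXn.
transitivity (\sum_(m <- rcons n 0) 'X^(absz m) : {poly R[i]}).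
  by rewrite -cats1 big_cat big_seq1.
by rewrite (big_nth 0) size_n big_mkord.
Qed.

Lemma exponent_poly_monic : (\sum_i 'X^(exponent n i) : {poly int}) \is monic.
Proof.
rewrite (bigD1 (Ordinal k_gt0)) //= monicE lead_coefDl ?lead_coefXn //.
rewrite size_polyXn ltnS; apply: leq_trans (size_sum _ _ _) _.
apply/bigmax_leqP => i hi; rewrite size_polyXn; apply: exponent_ltn.
by rewrite lt0n.
Qed.

End ExponentSet.

Lemma exponent_eq0 (k : nat) : (0 < k)%N ->
  exists i, forall n : k.-1.-tuple int, exponent n i = 0%N.
Proof.
move=> k0; have lt : (k.-1 < k)%N by rewrite ltn_predL.
by exists (Ordinal lt) => n; rewrite /exponent nth_rcons size_tuple ltnn eqxx.
Qed.

Lemma exponent_tuple_inj (k : nat) (n n' : k.-1.-tuple int) :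
  (0 < k)%N -> exponent_set k n -> exponent_set k n' ->
  exponent n =1 exponent n' -> n = n'.
Proof.
move=> k0 hn hn' e; apply: val_inj; apply: (@rcons_injl _ 0).
apply: (@eq_from_nth _ 0); first by rewrite !size_rcons !size_tuple.
move=> i; rewrite size_rcons size_tuple prednK // => ik.
by rewrite -(exponentE k0 hn (Ordinal ik)) e (exponentE k0 hn').
Qed.

(** * Finiteness for prime [k] *)

Section Prime.
Variables (R : realType) (k : nat).
Hypothesis k_gt1 : (1 < k)%N.
Let k_gt0 : (0 < k)%N := ltnW k_gt1.

Local Notation I := 'I_k.
Local Notation X := (I * I * 'I_(#|I|)`!)%type.

Lemma cyclotomic_factorization (n : k.-1.-tuple int) :
  cyclotomic_exponent_set R k n ->
  exists2 s : seq nat, all (leq 1) s & \sum_i 'X^(exponent n i) = \prod_(d <- s) 'Phi_d :> {poly int}.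
Proof.
case=> hn hM.
have mf := exponent_poly_monic k_gt0 hn.
have [i0 /(_ n) e0] := exponent_eq0 k_gt0.
rewrite (sum_polyE n k_gt0) in hM.
have mfC : map_poly intr (\sum_i 'X^(exponent n i) : {poly int}) \is @monic R[i].
  by rewrite monic_map.
have roots := (mahler_measure_eq1 mfC).1 hM.
apply: (prod_Cyclotomic_of_roots (C := R[i])) => // x hx.
apply: kronecker_root hx => //.
rewrite horner_sum (bigD1 i0) //= e0 expr0 hornerC big1 ?addr0 ?oner_neq0 // => i ii0.
rewrite hornerXn expr0n; case: eqP => // /esym ei; move: ii0.
by rewrite -(inj_eq (exponent_inj k_gt0 hn)) e0 ei eqxx.
Qed.

Definition has_profile (p : {ffun {set X} -> 'I_(#|I|)}) (n : k.-1.-tuple int) :=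
  exists s : seq nat, [/\ all (leq 1) s,
    \sum_i 'X^(exponent n i) = \prod_(d <- s) 'Phi_d :> {poly int},
    p (finset.set0) = 0%N :> nat &
    forall m, (0 < m)%N -> count_mem m s = p (gap_divisors (exponent n) m)].

(** The profile fixes the Moebius coefficients and hence the index types of the binomials; only
    their exponents [c n S] depend on [n]. The finite [code] records which exponents of the expanded
    identity coincide, and by [rigidity] it determines [n]. *)
Lemma finite_profile (p : {ffun {set X} -> 'I_(#|I|)}) : prime k ->
  finite_set [set n | exponent_set k n /\ has_profile p n].
Proof.
move=> pk.
have [a ha] := moebius_subset (fun B => (p B : nat)%:Z).
(* Each binomial is listed as often as it occurs in its product. *)
pose NT := {S : {set X} & 'I_(neg_part (a S))}; pose PT := {S : {set X} & 'I_(pos_part (a S))}.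
pose c (n : k.-1.-tuple int) (S : {set X}) :=
  (\big[gcdn/0]_(x in S) gap_exponent (exponent n) x)%N.
pose e (n : k.-1.-tuple int) := expansion (exponent n)
  (fun y : NT => c n (tag y)) (fun y : PT => c n (tag y)).
pose code (n : k.-1.-tuple int) : {ffun _ * _ -> bool} := [ffun q => e n q.1 == e n q.2].
apply: (@finite_set_inj _ _ _ code) => n n' /set_mem [hn [s [s0 fs p0 ps]]].
move=> /set_mem [hn' [s' [s0' fs' _ _]]] ecode.
have a0 : a finset.set0 = 0.
  transitivity (\sum_(S : {set X} | S \subset finset.set0) a S); last by rewrite -ha p0.
  by rewrite (big_pred1 finset.set0) // => S; rewrite finset.subset0.
have cpos m (S : {set X}) : a S != 0 -> (0 < c m S)%N.
  move=> aS; apply: biggcd_gap_exponent_gt0.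
  by apply: contraNneq aS => ->; rewrite a0.
have cN m (y : NT) : (0 < c m (tag y))%N.
  by apply: cpos; case: y => S [i lti] /=; apply: contraTneq lti => ->.
have cP m (y : PT) : (0 < c m (tag y))%N.
  by apply: cpos; case: y => S [i lti] /=; apply: contraTneq lti => ->.
have identity : (\sum_i 'X^(exponent n i)) * \prod_(y : NT) ('X^(c n (tag y)) - 1) =
    \prod_(y : PT) ('X^(c n (tag y)) - 1) :> {poly int}.
  have := cyclotomic_product_identity s0 ps ha a0; rewrite -fs -/(c n).
  have tagE (u : {set X} -> nat) :
      \prod_S ('X^(c n S) - 1) ^+ u S =
      \prod_(y : {S : {set X} & 'I_(u S)}) ('X^(c n (tag y)) - 1) :> {poly int}.
    rewrite -(sig_big_dep xpredT (fun S => xpredT) (fun S (_ : 'I_(u S)) => 'X^(c n S) - 1 : {poly int})) /=.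
    by apply: eq_bigr => S _; rewrite prodr_const card_ord.
  have := tagE (fun S => neg_part (a S)); have := tagE (fun S => pos_part (a S)).
  by move=> /= -> ->.
have pattern t u : e n t = e n u -> e n' t = e n' u.
  move=> etu; have := congr1 (fun g : {ffun _ * _ -> bool} => g (t, u)) ecode.
  by rewrite !ffunE /= etu eqxx => /esym/eqP.
have [i0 z0] := exponent_eq0 k_gt0.
have pI : prime #|I| by rewrite card_ord.
have [u [v [u0 v0 uv]]] := rigidity identity pattern (cN n) (cP n) pI (z0 n) (z0 n') (cN n') (cP n').
(* Taking gcds on both sides of [v * exponent n' i = u * exponent n i], as both families have gcd
   1. *)
have uv_eq : u = v.
  have : (\big[gcdn/0]_i (v * exponent n' i) = \big[gcdn/0]_i (u * exponent n i))%N.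
    by apply: eq_bigr => i _; rewrite uv.
  rewrite -!(big_morph (muln _) (muln_gcdr _) (muln0 _)).
  by rewrite (exponent_gcd k_gt0 hn) (exponent_gcd k_gt0 hn') !muln1.
apply: (exponent_tuple_inj k_gt0 hn hn') => i.
by have /eqP := uv i; rewrite uv_eq eqn_pmul2l // => /eqP.
Qed.

Lemma finite_of_prime : prime k -> finite_set (cyclotomic_exponent_set R k).
Proof.
move=> pk.
apply: sub_finite_set (bigcup_finite (@finite_finset _ [set: {ffun {set X} -> 'I_(#|I|)}])
  (fun p _ => finite_profile p pk)) => n hn.
have [s s0 fs] := cyclotomic_factorization hn.
have card_I : (1 < #|I|)%N by rewrite card_ord.
have [p [p0 ps]] := profile_exists (exponent_inj k_gt0 hn.1) card_I s0 fs.
by exists p => //; split; [exact: hn.1 | exists s].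
Qed.
End Prime.

(** * Infinitely many members for composite [k] *)

Section Composite.
Variables (R : realType) (a b : nat).
Hypotheses (a_gt1 : (1 < a)%N) (b_gt1 : (1 < b)%N).

(** For [t = i + j b] with [i < b] this is [i + j N], an exponent of [(1 + z + ... + z^(b-1)) (1 +
    z^N + ... + z^((a-1)N))]. *)
Definition grid_exponent (N t : nat) : nat := (t %% b + t %/ b * N)%N.

Lemma grid_exponent_ltn (N : nat) : (b <= N)%N ->
  {homo grid_exponent N : t u / (t < u)%N}.
Proof.
move=> bN t u tu; rewrite /grid_exponent.
have b0 : (0 < b)%N by apply: ltnW.
have := ltn_pmod t b0; have := ltn_pmod u b0.
have := divn_eq t b; have := divn_eq u b.
move: (t %/ b)%N (t %% b)%N (u %/ b)%N (u %% b)%N => q r q' r' e' e lr' lr.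
have qq : (q <= q')%N by nia.
have [eq|lt] := eqVneq q q'; first by subst q'; nia.
have {lt qq} lt : (q < q')%N by rewrite ltn_neqAle lt.
have : (q.+1 * N <= q' * N)%N by rewrite leq_mul2r lt orbT.
rewrite mulSn; lia.
Qed.

Lemma grid_tuple_size (N : nat) :
  size [seq (grid_exponent N t)%:Z | t <- rev (iota 1 (a * b).-1)] == (a * b).-1.
Proof. by rewrite size_map size_rev size_iota. Qed.

Definition grid_tuple (N : nat) : (a * b).-1.-tuple int := Tuple (grid_tuple_size N).

Let ab_gt0 : (0 < a * b)%N. Proof. by rewrite muln_gt0 (ltnW a_gt1) (ltnW b_gt1). Qed.

Lemma rcons_grid_tuple (N : nat) :
  rcons (grid_tuple N) 0 = rev [seq (grid_exponent N t)%:Z | t <- iota 0 (a * b)].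
Proof.
rewrite /= map_rev -rev_cons -{2}(prednK ab_gt0) /=.
by rewrite /grid_exponent mod0n div0n.
Qed.

Lemma grid_tuple_exponent_set (N : nat) : (b <= N)%N -> exponent_set (a * b) (grid_tuple N).
Proof.
move=> bN; split.
  rewrite rcons_grid_tuple rev_sorted sorted_map.
  apply: sub_sorted (iota_ltn_sorted 0 (a * b)) => t u /= tu.
  by rewrite ltz_nat; exact: grid_exponent_ltn.
have -> : \big[gcdz/0]_(m <- grid_tuple N) m = (\big[gcdn/0%N]_(m <- grid_tuple N) absz m)%:Z.
  elim: (tval (grid_tuple N)) => [|m s IHs]; first by rewrite !big_nil.
  by rewrite !big_cons IHs.
(* As [b > 1], the index [t = 1] has exponent 1, which forces the gcd to be 1. *)
have one : 1 \in tval (grid_tuple N).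
  apply/mapP; exists 1%N; last by rewrite /grid_exponent modn_small // divn_small.
  by rewrite mem_rev mem_iota /=; nia.
by rewrite (big_rem 1) //= gcd1n.
Qed.

(** The polynomial is a product of two geometric sums, so a root satisfies [z ^+ b = 1] or
    [z ^+ (N * a) = 1]. *)
Lemma grid_tuple_root (N : nat) (z : R[i]) : (0 < N)%N ->
  root (sum_poly R (grid_tuple N)) z -> `|z| <= 1.
Proof.
move=> N0 /rootP.
have -> : sum_poly R (grid_tuple N) = \sum_(t <- iota 0 (a * b)) 'X^(grid_exponent N t).
  transitivity (\sum_(m <- rcons (grid_tuple N) 0) 'X^(absz m) : {poly R[i]}).
    by rewrite -cats1 big_cat big_seq1.
  by rewrite rcons_grid_tuple big_rev big_map.
have -> : (\sum_(t <- iota 0 (a * b)) 'X^(grid_exponent N t) : {poly R[i]}).[z] =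
   (\sum_(i < b) z ^+ i) * (\sum_(j < a) (z ^+ N) ^+ j).
  rewrite horner_sum -[X in iota 0 X]subn0 -/(index_iota 0 (a * b)) big_nat_mul.
  rewrite mulr_sumr big_mkord; apply: eq_bigr => j _.
  rewrite -{1}[(j * b)%N]add0n big_addn mulSn addnK big_mkord mulr_suml.
  apply: eq_bigr => i _; rewrite hornerXn /grid_exponent.
  have b0 : (0 < b)%N by apply: ltnW.
  by rewrite [(i + j * b)%N]addnC modnMDl divnMDl // modn_small // divn_small // addn0 exprD mulnC exprM.
have norm1 m : (0 < m)%N -> z ^+ m = 1 -> `|z| <= 1.
  move=> m0 zm; have : `|z| ^+ m = 1 by rewrite -normrX zm normr1.
  by move/eqP; rewrite pexpr_eq1 // => /eqP ->.
move/eqP; rewrite mulf_eq0 => /orP[]/eqP h.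
  apply: (norm1 b); first exact: ltnW.
  by apply/eqP; rewrite -subr_eq0 subrX1 h mulr0.
apply: (norm1 (N * a)%N); first by rewrite muln_gt0 N0 (ltnW a_gt1).
by apply/eqP; rewrite -subr_eq0 exprM subrX1 h mulr0.
Qed.

Lemma infinite_composite : ~ finite_set (cyclotomic_exponent_set R (a * b)).
Proof.
move=> fin; pose g (N : nat) := grid_tuple (b + N).
have g_inj : injective g.
  (* The exponent of index [b] is the parameter of [grid_tuple] itself, and [b] is an admissible
     index because [a > 1]. *)
  move=> N N' /(congr1 (fun t : (a * b).-1.-tuple int => tval t)) /= /eq_in_map /(_ b).
  have -> : b \in rev (iota 1 (a * b).-1) by rewrite mem_rev mem_iota; nia.
  rewrite /grid_exponent modnn divnn (ltnW b_gt1) !mul1n !add0n.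
  by move=> /(_ isT) [] /addnI.
apply: infinite_nat; have -> : [set: nat] = g @^-1` cyclotomic_exponent_set R (a * b).
  apply/seteqP; split=> // N _.
  have hn : exponent_set (a * b) (g N) by apply: grid_tuple_exponent_set; rewrite leq_addr.
  split=> //; apply/mahler_measure_eq1.
    rewrite (sum_polyE (g N) ab_gt0) monic_map //.
    exact: exponent_poly_monic.
  move=> z; apply: grid_tuple_root; lia.
by apply: finite_preimage => // x y _ _; exact: g_inj.
Qed.

End Composite.

Theorem proposition2 (R : realType) (k : nat) (hk : (2 <= k)%N) :
  finite_set (cyclotomic_exponent_set R k) <-> prime k.
Proof.
split=> [fin|]; last exact: finite_of_prime.
apply: contrapT => /negP /primePn [|[d /andP[d1 dk] /dvdnP [a ka]]]; first by rewrite ltnNge hk.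
have a1 : (1 < a)%N by nia.
by move: fin; rewrite ka; exact: infinite_composite.
Qed.
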